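(* Let $k$ be an infinite field of characteristic $p\neq 2$ (with $p=0$ allowed). For any positive integer $m$, $$CP(G(m))=S_1(m)+T(G(m)).$$
   Context: $X=\{x_i\mid i\ge 1\}$ is a countable set of variables. $k_0\langle X\rangle$ is the free nonunitary associative $k$-algebra on $X$ and $k_1\langle X\rangle$ is the free unitary associative $k$-algebra on $X$. $[u,v]=uv-vu$. A $T$-space of $k_1\langle X\rangle$ is a linear subspace invariant under every (unital) algebra endomorphism of $k_1\langle X\rangle$. For a set $A\subseteq k_1\langle X\rangle$, $A^S$ denotes the smallest $T$-space of $k_1\langle X\rangle$ containing $A$. $G$ is the infinite dimensional unitary Grassmann algebra over $k$: it is generated by $1$ and elements $e_i$, $i\ge1$, with $e_ie_j=-e_je_i$ and $e_i^2=0$, and it has linear basis $1$ together with all products $e_{i_1}\cdots e_{i_n}$, $n\ge1$, $i_1<\cdots<i_n$. $G(m)$ is the unitary subalgebra of $G$ generated by $e_1,\ldots,e_m$. An element $f\in k_0\langle X\rangle$ is an identity of $G(m)$ if it lies in the kernel of every (unital) homomorphism $k_1\langle X\rangle\to G(m)$; $T(G(m))$ is the set of all identities of $G(m)$. An element $f\in k_0\langle X\rangle$ is a central polynomial of $G(m)$ if $f\notin T(G(m))$ and the image of $f$ under every (unital) homomorphism $k_1\langle X\rangle\to G(m)$ lies in the centre of $G(m)$. $CP(G(m))$ is the $T$-space of $k_1\langle X\rangle$ generated by the central polynomials of $G(m)$. $b_m=\lfloor m/2\rfloor+1$. For $j\ge 1$, $h_j=\prod_{r=1}^{j}[x_{2r-1},x_{2r}]$,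 and $h_0=1$. If $p=0$, $S_1=\{[x_1,x_2]\}^S$. If $p>2$, for each $n\ge1$ let $w_n=\prod_{j=1}^n[x_{2j-1},x_{2j}]x_{2j-1}^{p-1}x_{2j}^{p-1}$, and $S_1=\{[x_1,x_2],\,x_1^p\}^S+\{x_{2n+1}^p w_n\mid n\ge 1\}^S$. For any positive integer $m$, $S_1(m)=S_1+\{x_{2b_m-1}h_{b_m-1}\}^S$. *)

(* Defs.v *)
From HB Require Import structures.
From mathcomp Require Import all_boot all_order all_algebra finmap.
From mathcomp Require Import monalg.
From mathcomp Require Import boolp classical_sets functions cardinality.

Set Implicit Arguments.
Unset Strict Implicit.
Unset Printing Implicit Defensive.

Import GRing.Theory.

Local Open Scope ring_scope.

Section BasisProduct.
Local Open Scope fset_scope.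
Implicit Types A B C : {fset nat}.

(* The number of transpositions that sort the concatenation of the increasing
   enumerations of A and B. *)
Definition inversions A B : nat :=
  (\sum_(a <- A) \sum_(b <- B) (b < a))%N.

(* e_A e_B = gsign A B * e_(A u B), where e_A is the product of the e_i for i
   in A in increasing order. *)
Definition gsign (k : pzRingType) A B : k :=
  if fdisjoint A B then (-1) ^+ inversions A B else 0.

Lemma sum_fsetU A B (F : nat -> nat) : fdisjoint A B ->
  (\sum_(i <- A `|` B) F i = \sum_(i <- A) F i + \sum_(i <- B) F i)%N.
Proof.
move=> dAB; rewrite (big_fsetID _ (fun i => i \in A)) /=; congr (_ + _)%N.
  by apply: eq_fbigl => i; rewrite !inE /=; case: (i \in A); rewrite ?andbF.
apply: eq_fbigl => i; rewrite !inE /=.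
have [iA|//] := boolP (i \in A); rewrite /= ?orbF ?andbT //.
by rewrite (negbTE (fdisjointP dAB i iA)).
Qed.

Lemma inversionsUl A B C : fdisjoint A B ->
  inversions (A `|` B) C = (inversions A C + inversions B C)%N.
Proof. exact: sum_fsetU. Qed.

Lemma inversionsUr A B C : fdisjoint B C ->
  inversions A (B `|` C) = (inversions A B + inversions A C)%N.
Proof.
by move=> dBC; rewrite -big_split; apply: eq_bigr => a _; exact: sum_fsetU.
Qed.

Lemma gsign_cocycle (k : pzRingType) A B C :
  gsign k A B * gsign k (A `|` B) C = gsign k B C * gsign k A (B `|` C).
Proof.
rewrite /gsign fdisjointUX fdisjointXU.
have [dAB|_] := boolP (fdisjoint A B); last by rewrite /= mul0r mulr0.
have [dBC|_] := boolP (fdisjoint B C); last by rewrite /= andbF mul0r mulr0.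
rewrite /= andbT; case: ifP => _; last by rewrite !mulr0.
rewrite -!exprD inversionsUl // inversionsUr //.
by congr (_ ^+ _); rewrite addnA [RHS]addnC.
Qed.

Lemma gsign0l (k : pzRingType) A : gsign k fset0 A = 1.
Proof. by rewrite /gsign fdisjoint0X /inversions big_seq_fset0. Qed.

Lemma gsign0r (k : pzRingType) A : gsign k A fset0 = 1.
Proof.
rewrite /gsign fdisjointX0 /inversions big1 // => a _.
by rewrite big_seq_fset0.
Qed.

End BasisProduct.

Section Grassmann.
Local Open Scope fset_scope.
Variable k : comNzRingType.

(* The infinite dimensional unitary Grassmann algebra: formal linear
   combinations of finite sets A of naturals, A standing for e_A. *)
Definition grassmann := {malg k[{fset nat}]}.
HB.instance Definition _ := GRing.Lmodule.on grassmann.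

Implicit Types (g : grassmann) (A B : {fset nat}).

Definition gmul g1 g2 : grassmann :=
  \sum_(A <- msupp g1) \sum_(B <- msupp g2)
    << g1@_A * g2@_B * gsign k A B *g A `|` B >>.

Lemma gmulw (d1 d2 : {fset {fset nat}}) g1 g2 :
  msupp g1 `<=` d1 -> msupp g2 `<=` d2 ->
  gmul g1 g2 = \sum_(A <- d1) \sum_(B <- d2)
    << g1@_A * g2@_B * gsign k A B *g A `|` B >>.
Proof.
move=> le_d1 le_d2; rewrite /gmul (big_fset_incl _ le_d1) /=.
  apply/eq_bigr=> A _; apply/big_fset_incl => // B _ /mcoeff_outdom ->.
  by rewrite mulr0 mul0r monalgU0.
move=> A _ /mcoeff_outdom g1A.
by rewrite big1 => // B _; rewrite g1A !mul0r monalgU0.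
Qed.

Lemma gmulUU a b A B : gmul << a *g A >> << b *g B >> =
  << a * b * gsign k A B *g A `|` B >>.
Proof. by rewrite (gmulw msuppU_le msuppU_le) !big_seq_fset1 !mcoeffUU. Qed.

Lemma gmulDl : left_distributive gmul +%R.
Proof.
move=> g1 g2 g; have s := fsubset_refl (msupp g).
rewrite (gmulw (fsubsetUl (msupp g1) (msupp g2)) s).
rewrite (gmulw (fsubsetUr (msupp g1) (msupp g2)) s) (gmulw (msuppD_le g1 g2) s).
rewrite -big_split /=; apply/eq_bigr=> A _.
rewrite -big_split /=; apply/eq_bigr=> B _.
by rewrite mcoeffD !mulrDl monalgUD.
Qed.

Lemma gmulDr : right_distributive gmul +%R.
Proof.
move=> g g1 g2; have s := fsubset_refl (msupp g).
rewrite (gmulw s (fsubsetUl (msupp g1) (msupp g2))).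
rewrite (gmulw s (fsubsetUr (msupp g1) (msupp g2))) (gmulw s (msuppD_le g1 g2)).
rewrite -big_split /=; apply/eq_bigr=> A _.
rewrite -big_split /=; apply/eq_bigr=> B _.
by rewrite mcoeffD mulrDr mulrDl monalgUD.
Qed.

Lemma gmul0r : left_zero 0 gmul.
Proof. by move=> g; rewrite /gmul msupp0 big_seq_fset0. Qed.

Lemma gmulr0 : right_zero 0 gmul.
Proof. by move=> g; rewrite /gmul big1 // => A _; rewrite msupp0 big_seq_fset0. Qed.

Lemma gmul_suml I (r : seq I) (F : I -> grassmann) g :
  gmul (\sum_(i <- r) F i) g = \sum_(i <- r) gmul (F i) g.
Proof. exact: (big_morph (gmul^~ g) (fun _ _ => gmulDl _ _ _) (gmul0r _)). Qed.

Lemma gmul_sumr I (r : seq I) (F : I -> grassmann) g :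
  gmul g (\sum_(i <- r) F i) = \sum_(i <- r) gmul g (F i).
Proof. exact: (big_morph (gmul g) (fun _ _ => gmulDr _ _ _) (gmulr0 _)). Qed.

Lemma gmulEl g1 g2 :
  gmul g1 g2 = \sum_(A <- msupp g1) gmul << g1@_A *g A >> g2.
Proof. by rewrite {1}(monalgE g1) gmul_suml. Qed.

Lemma gmulEr g1 g2 :
  gmul g1 g2 = \sum_(B <- msupp g2) gmul g1 << g2@_B *g B >>.
Proof. by rewrite {1}(monalgE g2) gmul_sumr. Qed.

Lemma gmulA : associative gmul.
Proof.
move=> g1 g2 g3; rewrite [RHS]gmul_suml gmulEl; apply: eq_bigr => A _.
rewrite [LHS]gmul_sumr [RHS]gmul_suml; apply: eq_bigr => B _.
rewrite [LHS]gmul_sumr gmulEr; apply: eq_bigr => C _.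
rewrite !gmulUU fsetUA; congr << _ *g _ >>.
rewrite -!mulrA; congr (_ * (_ * _)).
by rewrite -gsign_cocycle mulrCA.
Qed.

Lemma gmul1r : left_id << fset0 >> gmul.
Proof.
move=> g; rewrite [in LHS](monalgE g) gmul_sumr [RHS]monalgE.
by apply: eq_bigr => A _; rewrite gmulUU gsign0l fset0U mul1r mulr1.
Qed.

Lemma gmulr1 : right_id << fset0 >> gmul.
Proof.
move=> g; rewrite [in LHS](monalgE g) gmul_suml [RHS]monalgE.
by apply: eq_bigr => A _; rewrite gmulUU gsign0r fsetU0 !mulr1.
Qed.

Lemma gone_neq0 : (<< fset0 >> : grassmann) != 0.
Proof. by rewrite monalgU_eq0 oner_eq0. Qed.

HB.instance Definition _ := GRing.Zmodule_isNzRing.Build grassmann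
  gmulA gmul1r gmulr1 gmulDl gmulDr gone_neq0.

Lemma gscaleU a b A : a *: << b *g A >> = << a * b *g A >> :> grassmann.
Proof. by apply/malgP => B; rewrite mcoeffZ !mcoeffU mulrnAr. Qed.

Lemma gscaleAl a g1 g2 : a *: (g1 * g2) = a *: g1 * g2.
Proof.
change (a *: gmul g1 g2 = gmul (a *: g1) g2).
rewrite (gmulw (msuppZ_le a g1) (fsubset_refl _)) /gmul scaler_sumr.
apply: eq_bigr => A _; rewrite scaler_sumr; apply: eq_bigr => B _.
by rewrite gscaleU mcoeffZ !mulrA.
Qed.

HB.instance Definition _ := GRing.Lmodule_isLalgebra.Build k grassmann gscaleAl.

Lemma gscaleAr a g1 g2 : a *: (g1 * g2) = g1 * (a *: g2).
Proof.
change (a *: gmul g1 g2 = gmul g1 (a *: g2)).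
rewrite (gmulw (fsubset_refl _) (msuppZ_le a g2)) /gmul scaler_sumr.
apply: eq_bigr => A _; rewrite scaler_sumr; apply: eq_bigr => B _.
by rewrite gscaleU mcoeffZ !mulrA (mulrC a).
Qed.

HB.instance Definition _ := GRing.Lalgebra_isAlgebra.Build k grassmann gscaleAr.

Definition gen (i : nat) : grassmann := << [fset i] >>.

Lemma gen_sqr i : gen i * gen i = 0.
Proof.
rewrite [LHS]gmulUU /gsign fdisjoint1X !inE eqxx /= mulr0.
by rewrite monalgU0.
Qed.

Lemma gen_anticomm i j : gen i * gen j = - (gen j * gen i).
Proof.
have [->|neq_ij] := eqVneq i j; first by rewrite gen_sqr oppr0.
rewrite [LHS]gmulUU [X in - X]gmulUU -monalgUN fsetUC; congr << _ *g _ >>.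
rewrite /gsign !fdisjoint1X !inE (eq_sym j) neq_ij /inversions !big_seq_fset1.
by case: ltngtP neq_ij => //= _ _; rewrite !mul1r ?opprK.
Qed.

(* With monalgE, the increasing products of generators are a linear basis. *)
Lemma prod_gen (s : seq nat) : sorted ltn s ->
  \prod_(i <- s) gen i = << [fset i | i in s] >>.
Proof.
elim: s => [|i s IHs] /= ps; first by rewrite big_nil fset_nil.
have/allP lt_i : all (ltn i) s by apply: order_path_min ps; apply: ltn_trans.
rewrite big_cons IHs ?(path_sorted ps) // [LHS]gmulUU fset_cons.
rewrite /gsign fdisjoint1X !inE /= ifT; last first.
  by apply/negP => /lt_i; rewrite /= ltnn.
congr << _ *g _ >>; rewrite !mul1r /inversions big_seq_fset1 big_seq big1 // => j.
by rewrite !inE /= => /lt_i /= lij; rewrite ltnNge ltnW.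
Qed.

End Grassmann.

Notation freealg k := {malg k[{fmonom nat}]}.

Local Open Scope classical_set_scope.

Definition has_characteristic (k : nzRingType) (p : nat) : Prop :=
  if p == 0%N then [pchar k] =i pred0 else p \in [pchar k].

Section TSpaces.
Variable k : fieldType.
Local Notation F := (freealg k).
Implicit Types (A B : set F) (f : F).

(* The variables are numbered from 1: the letter i - 1 is x_i. *)
Definition var (i : nat) : F := << fmu i.-1 >>.

Definition commutator (u v : F) : F := u * v - v * u.

(* k_0<X> as the subset of k_1<X> of elements without constant term. *)
Definition nonunitary : set F := [set f | f@_mone = 0].

Definition is_tspace A : Prop :=
  GRing.submod_closed (mem A) /\
  forall (phi : {lrmorphism F -> F}) f, A f -> A (phi f).

Definition tspace_gen A : set F := smallest is_tspace A.

Definition sumset A B : set F := [set f + g | f in A & g in B].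

Definition bnum (m : nat) : nat := m./2.+1.

Definition hpoly (j : nat) : F :=
  \prod_(1 <= r < j.+1) commutator (var (2 * r - 1)) (var (2 * r)).

Definition wpoly (p n : nat) : F :=
  \prod_(1 <= j < n.+1)
    (commutator (var (2 * j - 1)) (var (2 * j))
     * var (2 * j - 1) ^+ p.-1 * var (2 * j) ^+ p.-1).

Definition S1 (p : nat) : set F :=
  if p == 0%N then tspace_gen [set commutator (var 1) (var 2)]
  else sumset (tspace_gen [set commutator (var 1) (var 2); var 1 ^+ p])
              (tspace_gen [set var (2 * n + 1) ^+ p * wpoly p n |
                             n in [set n | (1 <= n)%N]]).

Definition S1m (p m : nat) : set F :=
  sumset (S1 p) (tspace_gen [set var (2 * bnum m - 1) * hpoly (bnum m - 1)]).

Variable m : nat.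

(* The generators e_1, ..., e_m are gen k 0, ..., gen k (m - 1). *)
Definition Gm : set (grassmann k) :=
  smallest (fun H : set (grassmann k) => GRing.subalg_closed (mem H))
           [set gen k i | i in [set i | (i < m)%N]].

Definition Gm_center : set (grassmann k) :=
  [set z | Gm z /\ forall y, Gm y -> z * y = y * z].

(* Unital homomorphisms to G(m) are those to G with image in G(m). *)
Definition into_Gm (phi : {lrmorphism F -> grassmann k}) : Prop :=
  forall f, Gm (phi f).

Definition TG : set F :=
  [set f | nonunitary f /\ forall phi, into_Gm phi -> phi f = 0].

Definition central_polynomial : set F :=
  [set f | [/\ nonunitary f, ~ TG f &
              forall phi, into_Gm phi -> Gm_center (phi f)]].

Definition CP : set F := tspace_gen central_polynomial.

End TSpaces.

Arguments var : clear implicits.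
Arguments hpoly : clear implicits.
Arguments wpoly : clear implicits.
Arguments S1 : clear implicits.
Arguments S1m : clear implicits.
Arguments Gm : clear implicits.
Arguments Gm_center : clear implicits.
Arguments TG : clear implicits.
Arguments central_polynomial : clear implicits.
Arguments CP : clear implicits.

(* Main.v *)
Require Import Defs.
From HB Require Import structures.
From mathcomp Require Import all_boot all_order all_algebra finmap.
From mathcomp Require Import monalg zify.
From mathcomp Require Import boolp classical_sets functions cardinality.

Set Implicit Arguments.
Unset Strict Implicit.
Unset Printing Implicit Defensive.

Import GRing.Theory.

Local Open Scope ring_scope.
Local Open Scope classical_set_scope.

(* Modulo the identities of the Grassmann algebra the free algebra behaves like
   the algebra of even differential forms: x_l takes values c_l + u_l with c_l
   central and u_l odd, a commutator takes the central value 2 u u', and the word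
   x_{s_1} ... x_{s_n} [x_{r_1}, x_{r_2}] [x_{r_3}, x_{r_4}] ... plays the role of
   the form t^s dt_r.  Exact forms correspond to sums of commutators, and f has
   central values in G(m) iff its components of degree at most m - 2 are closed.

   Since k is infinite it suffices to treat a multihomogeneous f.  If all its
   partial degrees vanish in k, every form t^s dt_r of this multidegree is, as in
   the Cartier isomorphism, a p-th power times prod_j t_{r_j}^(p-1) dt_{r_j}, and
   these are consequences of x^p and of the x^p w_n.  Otherwise some variable x_i
   has a degree d which is nonzero in k.  As in the Poincare lemma, one can
   integrate with respect to x_i: modulo commutators [g, x_j], f becomes a linear
   combination of forms t^s dt_I with i not in I.  The coefficient of dt_i dt_I in
   its differential is then d times the coefficient of dt_I in f, which therefore
   vanishes when |I| + 2 <= m; the remaining terms contain at least m/2 commutators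
   and are consequences of x h_{b - 1}. *)

(* [commutator] is the instance of [lie] at the free algebra. *)
Definition lie (R : pzRingType) (x y : R) : R := x * y - y * x.

(* [v r_1, v r_2] [v r_3, v r_4] ..., with the junk value 0 if r has odd size. *)
Fixpoint lie_prod (R : pzRingType) (v : nat -> R) (r : seq nat) : R :=
  match r with
  | a :: b :: r' => lie (v a) (v b) * lie_prod v r'
  | [:: _] => 0
  | [::] => 1
  end.

Lemma seq2_ind (T : Type) (P : seq T -> Prop) :
    P [::] -> (forall a, P [:: a]) ->
    (forall a b r, P r -> P [:: a, b & r]) ->
  forall r, P r.
Proof.
move=> P0 P1 P2 r; suff: P r /\ forall a, P (a :: r) by case.
by elim: r => [|b r [Pr Pbr]]; split=> // a; apply: P2.
Qed.

(** * Products of commutators in rings *)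

Section LieProd.
Variables (R S : pzRingType) (phi : {rmorphism R -> S}).

Lemma rmorph_lie x y : phi (lie x y) = lie (phi x) (phi y).
Proof. by rewrite /lie rmorphB !rmorphM. Qed.

Lemma rmorph_lie_prod v r : phi (lie_prod v r) = lie_prod (phi \o v) r.
Proof.
elim/seq2_ind: r => [|a|a b r IHr] /=; [exact: rmorph1 | exact: rmorph0 |].
by rewrite rmorphM rmorph_lie IHr.
Qed.

Lemma lieMl (x y z : R) : lie (x * y) z = x * lie y z + lie x z * y.
Proof. by rewrite /lie mulrBr mulrBl !mulrA addrA subrK. Qed.

(** The product is the shape of [wpoly], with the letters replaced by [v] and the exponent p - 1
    written [p]; the predecessors translate the numbering of variables from 1 into that of letters
    from 0. *)
Lemma rmorph_wprod v p n :
  phi (\prod_(1 <= j < n) (lie (v (2 * j - 1).-1%N) (v (2 * j).-1) *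
     v (2 * j - 1).-1%N ^+ p * v (2 * j).-1%N ^+ p)) =
  \prod_(1 <= j < n) (lie ((phi \o v) (2 * j - 1).-1%N) ((phi \o v) (2 * j).-1) *
     (phi \o v) (2 * j - 1).-1%N ^+ p * (phi \o v) (2 * j).-1%N ^+ p).
Proof.
rewrite rmorph_prod; apply: eq_bigr => j _.
by rewrite !rmorphM !rmorphXn rmorph_lie.
Qed.

Lemma commuting_mul (x y z : R) : x * z = z * x -> y * z = z * y ->
  x * y * z = z * (x * y).
Proof. by move=> xz yz; rewrite -mulrA yz mulrA xz mulrA. Qed.

Lemma lieDl (x y z : R) : lie (x + y) z = lie x z + lie y z.
Proof. by rewrite /lie mulrDl mulrDr opprD addrACA. Qed.

Lemma lieC (x y : R) : lie x y = - lie y x.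
Proof. by rewrite /lie opprB. Qed.

Lemma eq_in_lie_prod (v v' : nat -> R) r :
  {in r, v =1 v'} -> lie_prod v r = lie_prod v' r.
Proof.
elim/seq2_ind: r => [|a|a b r IHr] //= vE.
rewrite !vE ?inE ?eqxx ?orbT // IHr // => l lr.
by rewrite vE // !inE lr !orbT.
Qed.

Lemma lie_prod_map (v : nat -> R) (f : nat -> nat) r :
  lie_prod v (map f r) = lie_prod (v \o f) r.
Proof. by elim/seq2_ind: r => [|a|a b r IHr] //=; rewrite IHr. Qed.

Lemma lie_prod_cat (v : nat -> R) r1 r2 : ~~ odd (size r1) ->
  lie_prod v (r1 ++ r2) = lie_prod v r1 * lie_prod v r2.
Proof.
elim/seq2_ind: r1 => [|a|a b r IHr] //=; first by rewrite mul1r.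
by rewrite negbK => /IHr->; rewrite mulrA.
Qed.

(** The left side is the shape of [hpoly], which thus becomes an instance of [lie_prod]. *)
Lemma lie_prod_iota (v : nat -> R) n :
  \prod_(1 <= j < n.+1) lie (v (2 * j - 1).-1%N) (v (2 * j).-1) =
  lie_prod v (iota 0 n.*2).
Proof.
elim: n => [|n IHn]; first by rewrite big_geq.
rewrite big_nat_recr // IHn.
have -> : ((2 * n.+1 - 1).-1 = n.*2)%N by lia.
have -> : ((2 * n.+1).-1 = n.*2.+1)%N by lia.
have -> : n.+1.*2 = (n.*2 + 2)%N by rewrite addn2.
by rewrite iotaD add0n lie_prod_cat ?size_iota ?odd_double //= mulr1.
Qed.

End LieProd.

(** Up to sign, [u x] can be moved next to its other occurrence, where its square vanishes. *)
Lemma anticommuting_prod0 (R : pzRingType) (u : nat -> R) x r :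
    (forall a b, u a * u b = - (u b * u a)) -> (forall a, u a * u a = 0) ->
  x \in r -> u x * \prod_(l <- r) u l = 0.
Proof.
move=> uC u2; elim: r => // y r IHr.
rewrite inE big_cons mulrA => /predU1P[<-|/IHr xr].
  by rewrite u2 mul0r.
by rewrite uC mulNr -mulrA xr mulr0 oppr0.
Qed.

Lemma lie_prod_commuting0 (R : pzRingType) (v : nat -> R) x r : x \in r ->
  (forall z, v x * z = z * v x) -> lie_prod v r = 0.
Proof.
move=> + vx; elim/seq2_ind: r => // a b r IHr; rewrite !inE /=.
case/or3P=> [/eqP<-|/eqP<-|/IHr->]; last exact: mulr0.
  by rewrite /lie vx subrr mul0r.
by rewrite /lie vx subrr mul0r.
Qed.

(** Each commutator of two anticommuting elements is twice their product. *)
Lemma anticommuting_lie_prod (R : pzRingType) (u : nat -> R) r :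
    {in r &, forall a b, u a * u b = - (u b * u a)} -> ~~ odd (size r) ->
  lie_prod u r = (\prod_(l <- r) u l) *+ 2 ^ (size r)./2.
Proof.
elim/seq2_ind: r => [|a|a b r IHr] //= uC; first by rewrite big_nil.
rewrite negbK => /IHr-> => [|x y xr yr]; last first.
  by apply: uC; rewrite !inE ?xr ?yr !orbT.
rewrite /lie (uC b a) ?inE ?eqxx ?orbT // opprK -mulr2n.
by rewrite mulrnAl mulrnAr -mulrnA !big_cons mulrA expnS mulnC.
Qed.

Lemma lie_prod_add1 (R : pzRingType) (u : nat -> R) r :
  lie_prod (fun l => 1 + u l) r = lie_prod u r.
Proof.
elim/seq2_ind: r => [|a|a b r IHr] //=; rewrite IHr; congr (_ * _).
rewrite lieDl [lie 1 _]/lie mul1r mulr1 subrr add0r lieC lieDl.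
by rewrite [lie 1 _]/lie mul1r mulr1 subrr add0r -lieC.
Qed.

(** * Rings whose elements split into a central and an anticommuting part *)

Section SuperRing.
Variables (G : pzRingType) (ev od : G -> G).

(** An abstraction of the even and odd parts in the Grassmann algebra. The vanishing of odd squares
    is a separate condition because 2 need not be invertible in [G]. *)
Definition super_split :=
  [/\ forall g, g = ev g + od g,
      forall g h, ev g * h = h * ev g,
      forall g h, od g * od h = - (od h * od g)
    & forall g, od g * od g = 0].

Hypothesis sG : super_split.
Let evodE : forall g, g = ev g + od g. Proof. by case: sG. Qed.
Let evC : forall g h, ev g * h = h * ev g. Proof. by case: sG. Qed.
Let odC : forall g h, od g * od h = - (od h * od g). Proof. by case: sG. Qed.
Let od2 : forall g, od g * od g = 0. Proof. by case: sG. Qed.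

Lemma super_lieE (g h : G) : lie g h = od g * od h *+ 2.
Proof.
have lie0 x y : lie (ev x) y = 0 by rewrite /lie evC subrr.
rewrite (evodE g) lieDl -evodE lie0 add0r lieC (evodE h) lieDl -evodE lie0 add0r.
by rewrite -lieC /lie (odC h) opprK mulr2n.
Qed.

(** The commutator is twice a product of two odd parts, and such a product passes an odd element
    with two sign changes. *)
Lemma super_lie_central (g h z : G) : lie g h * z = z * lie g h.
Proof.
rewrite super_lieE mulrnAl mulrnAr; congr (_ *+ 2).
have odz : od g * od h * od z = od z * (od g * od h).
  by rewrite -mulrA (odC h z) mulrN mulrA (odC g z) mulNr opprK mulrA.
by rewrite (evodE z) mulrDl mulrDr -evC odz.
Qed.

Lemma super_lie_prod_central (v : nat -> G) r z :
  lie_prod v r * z = z * lie_prod v r.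
Proof.
elim/seq2_ind: r => [|a|a b r IHr] /=; rewrite ?mul1r ?mulr1 ?mul0r ?mulr0 //.
by rewrite -mulrA IHr mulrA super_lie_central mulrA.
Qed.

Lemma super_lieX (x y : G) n : lie (x ^+ n.+1) y = x ^+ n * lie x y *+ n.+1.
Proof.
elim: n => [|n IHn]; first by rewrite expr1 expr0 mul1r.
by rewrite exprS lieMl IHn super_lie_central mulrnAr mulrA -exprS -mulrSr.
Qed.

Lemma super_lie_prodE (v : nat -> G) r : lie_prod v r =
  if odd (size r) then 0 else (\prod_(l <- r) od (v l)) *+ 2 ^ (size r)./2.
Proof.
elim/seq2_ind: r => [|a|a b r IHr] //=; first by rewrite big_nil.
rewrite IHr negbK super_lieE; case: odd; first by rewrite mulr0.
by rewrite mulrnAl mulrnAr -mulrnA !big_cons mulrA expnS mulnC.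
Qed.

Lemma super_prod_od_cons (v : nat -> G) x r :
  x \in r -> od (v x) * \prod_(l <- r) od (v l) = 0.
Proof. exact: anticommuting_prod0. Qed.

Lemma super_prod_od_dup (v : nat -> G) r :
  ~~ uniq r -> \prod_(l <- r) od (v l) = 0.
Proof.
elim: r => //= x r IHr; rewrite negb_and negbK big_cons.
by move=> /orP[/super_prod_od_cons//|/IHr->]; rewrite mulr0.
Qed.

(** The odd part of a letter of [s] is annihilated by the commutators, which already contain that
    odd factor; only the central parts of the word survive. This is why the values of w_n are
    central. *)
Lemma super_word_lie_central (v : nat -> G) s r z : {subset s <= r} ->
  (\prod_(l <- s) v l) * lie_prod v r * z =
  z * ((\prod_(l <- s) v l) * lie_prod v r).
Proof.
move=> sr; have odr l : l \in r -> od (v l) * lie_prod v r = 0.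
  move=> lr; rewrite super_lie_prodE; case: odd; first exact: mulr0.
  by rewrite mulrnAr super_prod_od_cons // mul0rn.
have -> : (\prod_(l <- s) v l) * lie_prod v r =
    (\prod_(l <- s) ev (v l)) * lie_prod v r.
  elim: s sr => [|l s IHs] sr; first by rewrite !big_nil.
  rewrite !big_cons -!mulrA IHs => [|x xs]; last by apply: sr; rewrite inE xs orbT.
  rewrite {1}(evodE (v l)) mulrDl -(super_lie_prod_central v r) (mulrA (od _)).
  by rewrite odr ?sr ?mem_head // mul0r addr0.
have evP w : (\prod_(l <- s) ev (v l)) * w = w * \prod_(l <- s) ev (v l).
  elim: (s) => [|l t IHt]; first by rewrite !big_nil mul1r mulr1.
  by rewrite !big_cons -mulrA IHt mulrA evC mulrA.
by rewrite -mulrA super_lie_prod_central mulrA evP mulrA.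
Qed.

(** By [super_lieX] the commutator of a p-th power carries the factor p. *)
Lemma super_expr_central p (x y : G) : p%:R = 0 :> G -> x ^+ p * y = y * x ^+ p.
Proof.
case: p => [|p] p0; first by rewrite mul1r mulr1.
by apply/eqP; rewrite -subr_eq0 -/(lie _ _) super_lieX -mulr_natr p0 mulr0.
Qed.

(** Commutators are central, so they can be collected behind all the powers; this brings the values
    of w_n into the form word times commutators. *)
Lemma super_wprodE (v : nat -> G) p n :
  \prod_(1 <= j < n.+1) (lie (v (2 * j - 1).-1%N) (v (2 * j).-1) *
     v (2 * j - 1).-1%N ^+ p * v (2 * j).-1%N ^+ p) =
  (\prod_(l <- flatten [seq nseq p l | l <- iota 0 n.*2]) v l) *
    lie_prod v (iota 0 n.*2).
Proof.
have powE l : \prod_(x <- nseq p l) v x = v l ^+ p by rewrite big_nseq iter_mulr_1.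
elim: n => [|n IHn]; first by rewrite big_geq // big_nil mulr1.
rewrite big_nat_recr // IHn.
have -> : ((2 * n.+1 - 1).-1 = n.*2)%N by lia.
have -> : ((2 * n.+1).-1 = n.*2.+1)%N by lia.
have -> : n.+1.*2 = (n.*2 + 2)%N by rewrite addn2.
rewrite iotaD add0n lie_prod_cat ?size_iota ?odd_double // map_cat flatten_cat big_cat.
rewrite /= cats0 big_cat !powE mulr1.
rewrite -!mulrA; congr (_ * _); rewrite super_lie_prod_central !mulrA.
by rewrite -!mulrA super_lie_central !mulrA.
Qed.
End SuperRing.

Lemma perm_cons_split (T : eqType) (x : T) s t : perm_eq (x :: s) t ->
  exists a b, t = a ++ x :: b /\ perm_eq s (a ++ b).
Proof.
move=> /[dup] /perm_mem/(_ x); rewrite inE eqxx => /esym/splitPr[a b] st.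
exists a, b; split=> //; rewrite -(perm_cons x) (perm_trans st) //.
by rewrite -[x :: b]cat1s perm_catCA.
Qed.

(** Reordering the odd parts costs a sign. It is chosen before the ring and [v], so that in
    [word_lie_perm_lie] one scalar serves for all homomorphisms at once. *)
Lemma super_lie_prod_perm r r' : perm_eq r r' -> exists e : bool,
  forall (G : pzRingType) (ev od : G -> G), super_split ev od ->
  forall v : nat -> G, lie_prod v r' = (-1) ^+ e * lie_prod v r.
Proof.
move=> rr'; suff [e He] : exists e : bool,
    forall (G : pzRingType) (ev od : G -> G), super_split ev od ->
    forall v : nat -> G,
      \prod_(l <- r') od (v l) = (-1) ^+ e * \prod_(l <- r) od (v l).
  exists e => G ev od sG v; rewrite !(super_lie_prodE sG) (perm_size rr').
  by case: odd; rewrite ?mulr0 // (He _ _ _ sG) mulrnAr.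
elim: r r' {rr'}(rr') => [|x r IHr] r'.
  by move=> /perm_size/esym/size0nil->; exists false => *; rewrite mul1r.
move=> /perm_cons_split[a [b [-> /IHr[e He]]]].
(* The head [x] has to pass the [size a] factors in front of it. *)
exists (odd (size a) (+) e) => G ev od sG v; rewrite signr_addb.
suff -> : \prod_(l <- a ++ x :: b) od (v l) =
    (-1) ^+ size a * (od (v x) * \prod_(l <- a ++ b) od (v l)).
  rewrite (He _ _ _ sG) big_cons signr_odd -!mulrA; congr (_ * _).
  by rewrite !mulrA commr_sign.
elim: a {He} => [|y a IHa] /=; first by rewrite !big_cons mul1r.
rewrite !big_cons IHa exprS mulN1r mulNr; case: sG => _ _ odC _.
rewrite (mulrA _ ((-1) ^+ _)) commr_sign -!mulrA (mulrA (od (v y))).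
by rewrite (odC (v y)) mulNr mulrN !mulrA.
Qed.

(** The counterpart of the differential form t^s dt_r. *)
Definition word_lie (R : pzRingType) (v : nat -> R) (s r : seq nat) : R :=
  (\prod_(l <- s) v l) * lie_prod v r.

Lemma rmorph_word_lie (R S : pzRingType) (phi : {rmorphism R -> S}) v s r :
  phi (word_lie v s r) = word_lie (phi \o v) s r.
Proof. by rewrite /word_lie rmorphM rmorph_prod rmorph_lie_prod. Qed.

Lemma rmorph2_exprM (R S T : pzRingType) (phi : {rmorphism S -> T})
    (psi : {rmorphism R -> S}) a b n :
  phi (psi (a ^+ n * b)) = phi (psi a) ^+ n * phi (psi b).
Proof. by rewrite !rmorphM !rmorphXn. Qed.

Lemma prod_flatten_nseq (R : pzRingType) (v : nat -> R) n y :
  \prod_(l <- flatten (nseq n y)) v l = (\prod_(l <- y) v l) ^+ n.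
Proof.
by elim: n => [|n IHn]; rewrite /= ?big_nil // big_cat IHn exprS.
Qed.

(** For n = p and e = p - 1, the left side is a value of x^p w after renaming the variables of w to
    the entries of [r] and substituting the word [y] for x; the right side has the word found in
    [perm_pth_power]. *)
Lemma word_lie_pth_power (R : pzRingType) (v v' : nat -> R) e n y r :
    (forall l, (l < size r)%N -> v' l = v (nth 0%N r l)) ->
  (\prod_(l <- y) v l) ^+ n *
    word_lie v' (flatten [seq nseq e l | l <- iota 0 (size r)]) (iota 0 (size r)) =
  word_lie v (flatten (nseq n y) ++ flatten [seq nseq e l | l <- r]) r.
Proof.
move=> vE; rewrite /word_lie big_cat prod_flatten_nseq mulrA; congr (_ * _ * _).
  rewrite !big_flatten !big_map -[r in RHS]take_size.
  rewrite -(map_nth_iota0 0%N (leqnn _)) big_map.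
  apply: eq_big_seq => l; rewrite mem_iota => /andP[_ /vE v'l].
  by rewrite !big_nseq v'l.
rewrite -[r in RHS]take_size -(map_nth_iota0 0%N (leqnn _)) lie_prod_map.
by apply: eq_in_lie_prod => l; rewrite mem_iota => /andP[_ /vE].
Qed.

(** Commutators have central values, so the first n of them may be moved behind the others. The
    surplus ones can then be absorbed in the variable x of x h. *)
Lemma rmorph_word_lie_split (R G : pzRingType) (phi : {rmorphism R -> G})
    (ev od : G -> G) (v : nat -> R) n s r : super_split ev od ->
    (n.*2 <= size r)%N ->
  phi (word_lie v s (drop n.*2 r) * lie_prod v (take n.*2 r)) =
  phi (word_lie v s r).
Proof.
move=> sG nr; rewrite rmorphM !rmorph_word_lie rmorph_lie_prod /word_lie.
rewrite -[r in RHS](cat_take_drop n.*2).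
rewrite lie_prod_cat; last by rewrite size_takel ?odd_double.
by rewrite -mulrA (super_lie_prod_central sG).
Qed.

Lemma perm_exchange (T : eqType) (x y : T) s t :
  perm_eq ((x :: s) ++ y :: t) ((y :: s) ++ x :: t).
Proof. by apply/permP => P; rewrite /= !count_cat /=; lia. Qed.

Lemma word_lie_commuting0 (R : pzRingType) (v : nat -> R) s x r : x \in r ->
  (forall z, v x * z = z * v x) -> word_lie v s r = 0.
Proof. by move=> xr vx; rewrite /word_lie (lie_prod_commuting0 xr) ?mulr0. Qed.

(** * Spanning by words times commutators *)

Section Spanning.
Variables (k : fieldType) (F G : lalgType k) (ev od : G -> G).
Hypothesis sG : super_split ev od.
Variables (X : nat -> F) (W : F -> Prop).
Hypothesis W0 : W 0.
Hypothesis WD : forall f g, W f -> W g -> W (f + g).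
Hypothesis WZ : forall a f, W f -> W (a *: f).
Hypothesis WI : forall f, (forall phi : {lrmorphism F -> G}, phi f = 0) -> W f.

Local Notation wl := (word_lie X).

Let WN f : W f -> W (- f). Proof. by rewrite -scaleN1r => /WZ. Qed.

Lemma mod_identities f g : (forall phi : {lrmorphism F -> G}, phi f = phi g) ->
  W f -> W g.
Proof.
move=> fg Wf; rewrite -(subrK f g); apply: WD => //.
by apply: WI => phi; rewrite rmorphB /= fg subrr.
Qed.

(* Modulo identities commutators are central, so exchanging adjacent letters costs
   a word with two letters fewer and one more commutator. *)
Lemma swap_letters a b x y r :
  W (wl (a ++ b) [:: y, x & r]) ->
  W (wl (a ++ y :: x :: b) r - wl (a ++ x :: y :: b) r).
Proof.
apply: mod_identities => phi; rewrite rmorphB !rmorph_word_lie /word_lie.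
rewrite !big_cat !big_cons /= -mulrBl [LHS]mulrA; congr (_ * _).
rewrite -mulrBr -[LHS]mulrA; congr (_ * _).
by rewrite -(super_lie_central sG) /lie mulrBl !mulrA.
Qed.

(** The induction hypothesis for reordering: the error terms have the same letters, more of them
    inside commutators. *)
Definition lower_in (s r : seq nat) := forall s' r',
  (size s' < size s)%N -> perm_eq (s' ++ r') (s ++ r) -> W (wl s' r').

Lemma lower_perm s s' r : perm_eq s s' -> lower_in s r -> lower_in s' r.
Proof.
move=> ss' H t u; rewrite -(perm_size ss') => lt tu; apply: H => //.
by rewrite (perm_trans tu) // perm_cat2r perm_sym.
Qed.

Lemma move_letter p a b x r : lower_in (p ++ x :: a ++ b) r ->
  W (wl (p ++ a ++ x :: b) r - wl (p ++ x :: a ++ b) r).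
Proof.
elim/last_ind: a b => [|a y IHa] b H; first by rewrite subrr.
rewrite !cat_rcons in H *.
rewrite -(subrK (wl (p ++ a ++ x :: y :: b) r) (wl _ _)) -addrA.
apply: WD; last exact: IHa.
rewrite !catA; apply: swap_letters; apply: H.
  by rewrite !size_cat /= !size_cat /= !addnS ltnS addnA leqnSn.
apply/permP => P; rewrite !count_cat /= !count_cat /=.
lia.
Qed.

Lemma permute_word s s' r : perm_eq s s' -> lower_in s r ->
  W (wl s r - wl s' r).
Proof.
(* A common prefix [p] is introduced to collect the letters that are already in place. *)
rewrite -[s]cat0s -[s']cat0s; move: [::] => p; rewrite perm_cat2l.
elim: s s' p => [|x s IHs] s' p.
  by move=> /perm_size/esym/size0nil-> _; rewrite subrr.
move=> /[dup] pss' /perm_cons_split[a [b [-> sab]]] H.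
rewrite -(subrK (wl (p ++ x :: a ++ b) r) (wl _ _)) -addrA; apply: WD.
  by rewrite -!cat_rcons; apply: IHs => //; rewrite cat_rcons.
rewrite -opprB; apply/WN/move_letter; apply: lower_perm H.
by rewrite perm_cat2l perm_cons.
Qed.

Lemma word_lie_perm_lie s r r' : perm_eq r r' -> W (wl s r) -> W (wl s r').
Proof.
move=> /super_lie_prod_perm[e He] Wr.
apply: (@mod_identities ((-1) ^+ e *: wl s r)); last exact: WZ.
move=> phi; rewrite linearZ /= !rmorph_word_lie /word_lie (He _ _ _ sG).
by rewrite mulrA commr_sign -mulrA scaler_sign mulr_sign; case: (e).
Qed.

(** For odd size [lie_prod] has its default value 0; a repeated letter contributes the same odd
    factor twice. *)
Lemma word_lie_degenerate s r : odd (size r) || ~~ uniq r -> W (wl s r).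
Proof.
move=> H; apply: WI => phi; rewrite rmorph_word_lie /word_lie (super_lie_prodE sG).
case: odd H => /= [_|/(super_prod_od_dup sG)->]; first by rewrite mulr0.
by rewrite mul0rn mulr0.
Qed.

Lemma representative s r s' r' : perm_eq s s' -> perm_eq r r' ->
  lower_in s r -> W (wl s' r') -> W (wl s r).
Proof.
move=> ss' rr' H W'; rewrite -(subrK (wl s' r) (wl s r)); apply: WD.
  exact: permute_word.
by apply: word_lie_perm_lie W'; rewrite perm_sym.
Qed.

(** Reordering only creates words with fewer letters outside the commutators, so induction on
    [size s] reduces to one order of [s] and of [r]. *)
Lemma spanning_of_representatives b :
    (forall s r, perm_eq (s ++ r) b -> uniq r -> ~~ odd (size r) ->
       exists s' r', [/\ perm_eq s s', perm_eq r r' & W (wl s' r')]) ->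
  forall s r, perm_eq (s ++ r) b -> W (wl s r).
Proof.
move=> H s; have [n] := ubnP (size s); elim: n s => // n IHn s /ltnSE sn r srb.
have [/word_lie_degenerate//|] := boolP (odd (size r) || ~~ uniq r).
rewrite negb_or negbK => /andP[er ur].
have [s' [r' [ss' rr' W']]] := H s r srb ur er.
apply: representative ss' rr' _ W' => t u ts tu.
by apply: IHn; [exact: leq_trans ts sn | exact: perm_trans tu srb].
Qed.

(** By the Leibniz rule the commutator of a word with a letter is a sum over the letters [l] of the
    word, and each resulting central factor can be moved to the end. *)
Lemma lie_word_in p t r j :
    (forall a l b, t = a ++ l :: b -> W (wl (p ++ a ++ b) [:: l, j & r])) ->
  W (\prod_(l <- p) X l * lie (\prod_(l <- t) X l) (X j) * lie_prod X r).
Proof.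
elim: t p => [|x t IHt] p H.
  by rewrite big_nil /lie mul1r mulr1 subrr mulr0 mul0r.
rewrite big_cons lieMl mulrDr mulrDl; apply: WD.
  have pxE : \prod_(l <- rcons p x) X l = \prod_(l <- p) X l * X x.
    by rewrite big_rcons.
  rewrite (mulrA (\prod_(l <- p) X l)) -pxE; apply: IHt => a l b tE.
  by rewrite cat_rcons; apply: (H (x :: a)); rewrite tE.
have := H [::] x t erefl; apply: mod_identities => phi.
rewrite rmorph_word_lie /word_lie !rmorphM !rmorph_prod rmorph_lie rmorph_lie_prod /=.
rewrite big_cat /= [LHS]mulrA; congr (_ * _).
by rewrite (super_lie_central sG) mulrA.
Qed.

(** Integration with respect to x_i: modulo commutators with a letter, a word with i inside a
    commutator is a combination of words with i outside, after division by the degree in x_i. *)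
Lemma spanning_off_letter b i : (count_mem i b)%:R != 0 :> k ->
    (forall f j, W (lie f (X j))) ->
    (forall s r, perm_eq (s ++ r) b -> uniq r -> ~~ odd (size r) -> i \notin r ->
       exists s' r', [/\ perm_eq s s', perm_eq r r' & W (wl s' r')]) ->
  forall s r, perm_eq (s ++ r) b -> W (wl s r).
Proof.
move=> ib WL H s; have [n] := ubnP (size s); elim: n s => // n IHn s /ltnSE sn.
have lower t u : (size t <= n)%N -> perm_eq (t ++ u) b -> lower_in t u.
  move=> tn tub s' r' s't s'r'.
  by apply: IHn; [exact: leq_trans s't tn | exact: perm_trans tub].
(* The case of i outside the commutators comes first: integration produces such words with as many
   letters outside as [s] has, which the induction hypothesis does not cover. *)
have off t u : size t = size s -> perm_eq (t ++ u) b -> i \notin u -> W (wl t u).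
  move=> ts tub iu.
  have [/word_lie_degenerate//|] := boolP (odd (size u) || ~~ uniq u).
  rewrite negb_or negbK => /andP[eu uu].
  have [t' [u' [tt' uu' W']]] := H t u tub uu eu iu.
  by apply: representative tt' uu' _ W'; apply: lower; rewrite ?ts.
move=> r srb; have [ir|/off] := boolP (i \in r); last exact.
have [/word_lie_degenerate//|] := boolP (odd (size r) || ~~ uniq r).
rewrite negb_or negbK => /andP[er ur].
have [j [r' rr']] : exists j r', perm_eq r [:: i, j & r'].
  have := perm_to_rem ir; case: (rem i r) (size_rem ir) => [|j r'] /= sr rr'.
    by have := perm_size rr'; move: er => /[swap] ->.
  by exists j, r'.
have : uniq [:: i, j & r'] by rewrite -(perm_uniq rr').
rewrite /= inE negb_or => /and3P[/andP[ij ir'] jr' ur'].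
pose d := count_mem i s; pose t := [seq l <- s | l != i].
have st : perm_eq s (nseq d i ++ t).
  have <- : [seq l <- s | l == i] = nseq d i.
    by rewrite /d -size_filter; apply/all_pred1P/filter_all.
  by rewrite perm_sym; apply/permEl/perm_filterC.
apply: (representative st rr'); first exact: lower.
(* One occurrence of i is inside the commutators, so the factor d + 1 below is the degree in x_i,
   which is invertible. *)
have dE : count_mem i b = d.+1.
  rewrite -(permP srb) count_cat (permP rr') /= eqxx eq_sym (negbTE ij) add1n.
  by rewrite add0n (count_memPn ir') addn1.
(* [x_i^(d+1) M c, x_j] is (d+1) x_i^d M [x_i, x_j] c + x_i^(d+1) [M, x_j] c, where
   M does not contain x_i and c, a product of commutators, is central. *)
have Wd : W (d.+1%:R *: wl (nseq d i ++ t) [:: i, j & r']).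
  have Wt : W (\prod_(l <- nseq d.+1 i) X l * lie (\prod_(l <- t) X l) (X j)
               * lie_prod X r').
    apply: lie_word_in => a l c tE.
    have lt : l \in t by rewrite tE mem_cat inE eqxx orbT.
    have dab : perm_eq (nseq d i ++ t) (l :: nseq d i ++ a ++ c).
      by rewrite tE catA -[l :: c]cat1s perm_catCA /= catA.
    apply: off.
    - by rewrite (perm_size st) (perm_size dab) /= !size_cat size_nseq.
    - rewrite -(permPr srb) perm_sym; apply: perm_trans (perm_cat st rr') _.
      apply: perm_trans (perm_cat dab (perm_refl _)) _.
      exact: perm_exchange.
    - rewrite !inE negb_or eq_sym; move: lt; rewrite mem_filter eq_sym => /andP[-> _].
      by rewrite negb_or ij.
  have := WD (WL (wl (nseq d.+1 i ++ t) r') j) (WN Wt).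
  apply: mod_identities => phi.
  have prodE n' : \prod_(l <- nseq n' i) (phi \o X) l = phi (X i) ^+ n'.
    by rewrite big_nseq iter_mulr_1.
  rewrite rmorphB linearZ rmorph_lie !rmorph_word_lie !rmorphM rmorph_lie.
  rewrite !rmorph_prod rmorph_lie_prod /word_lie !big_cat !prodE.
  rewrite /= (@lieMl G) [lie (lie_prod _ _) _]/lie (super_lie_prod_central sG).
  rewrite subrr mulr0 add0r (@lieMl G) mulrDl [_ + _ - _]addrAC addrN add0r.
  rewrite (super_lieX sG) scaler_nat !mulrnAl; congr (_ *+ _).
  by rewrite -!mulrA; congr (_ * _); rewrite !mulrA (super_lie_central sG).
by move/(WZ (d.+1%:R)^-1): Wd; rewrite scalerA mulVf ?scale1r // -dE.
Qed.
End Spanning.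

(** * The Grassmann algebra *)

Section GrassmannParity.
Variable k : comNzRingType.
Local Notation G := (grassmann k).
Implicit Types (g h : G) (A B : {fset nat}).

Lemma gmonE a A b B : (<< a *g A >> : G) * << b *g B >> =
  << a * b * gsign k A B *g (A `|` B)%fset >>.
Proof. exact: gmulUU. Qed.

Lemma gmul_expand g h : g * h =
  \sum_(A <- msupp g) \sum_(B <- msupp h)
    (<< g@_A *g A >> : G) * << h@_B *g B >>.
Proof.
apply: eq_bigr => A _; apply: eq_bigr => B _; exact/esym/gmonE.
Qed.

Definition supported_in (P : pred {fset nat}) g := forall A, g@_A != 0 -> P A.

Lemma supported_in0 P : supported_in P 0.
Proof. by move=> A; rewrite mcoeff0 eqxx. Qed.

Lemma supported_inD P g h :
  supported_in P g -> supported_in P h -> supported_in P (g + h).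
Proof.
move=> Pg Ph A; rewrite mcoeffD.
have [->|/Pg//] := eqVneq g@_A 0; rewrite add0r; exact: Ph.
Qed.

Lemma supported_in_sum P I (r : seq I) (Q : pred I) (f : I -> G) :
  (forall i, Q i -> supported_in P (f i)) ->
  supported_in P (\sum_(i <- r | Q i) f i).
Proof.
by move=> Pf; elim/big_ind: _ => //; [exact: supported_in0 | exact: supported_inD].
Qed.

Lemma supported_inZ P a g : supported_in P g -> supported_in P (a *: g).
Proof.
move=> Pg A; rewrite mcoeffZ => agA; apply: Pg.
by apply: contraNneq agA => ->; rewrite mulr0.
Qed.

Lemma supported_inU (P : pred {fset nat}) a A :
  P A -> supported_in P << a *g A >>.
Proof.
by move=> PA B; rewrite mcoeffU; case: (A =P B) => [<-//|_]; rewrite eqxx.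
Qed.

(** Overlapping index sets have sign 0, so only disjoint pairs contribute. *)
Lemma supported_inM (P Q R : pred {fset nat}) g h :
    (forall A B, P A -> Q B -> [disjoint A & B]%fset -> R (A `|` B)%fset) ->
  supported_in P g -> supported_in Q h -> supported_in R (g * h).
Proof.
move=> PQR Pg Qh; rewrite gmul_expand; apply: supported_in_sum => A _.
apply: supported_in_sum => B _; rewrite gmonE.
have [->|/Pg PA] := eqVneq g@_A 0.
  by rewrite !mul0r monalgU0; apply: supported_in0.
have [->|/Qh QB] := eqVneq h@_B 0.
  by rewrite mulr0 mul0r monalgU0; apply: supported_in0.
rewrite /gsign; case: ifP => dAB; first exact/supported_inU/PQR.
by rewrite mulr0 monalgU0; apply: supported_in0.
Qed.

(** Each pair of distinct elements is inverted in exactly one of the two orders. *)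
Lemma inversionsC A B : fdisjoint A B ->
  (inversions A B + inversions B A = #|` A| * #|` B|)%N.
Proof.
move=> dAB; rewrite /inversions [X in (_ + X)%N]exchange_big -big_split /=.
rewrite -sum1_size big_distrl /= !big_seq; apply: eq_bigr => a aA.
rewrite mul1n -sum1_size -big_split /= !big_seq; apply: eq_bigr => b bB.
by case: ltngtP => // ab; move: (fdisjointP dAB a aA); rewrite -ab bB.
Qed.

Lemma gsignC A B : gsign k A B = (-1) ^+ (#|` A| * #|` B|) * gsign k B A.
Proof.
rewrite /gsign fdisjoint_sym; case: ifP; last by rewrite mulr0.
rewrite fdisjoint_sym => /inversionsC <-; rewrite exprD -mulrA.
by rewrite -expr2 sqrr_sign mulr1.
Qed.

Lemma gmul_parity b c g h :
    supported_in (fun A => odd #|` A| == b) g ->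
    supported_in (fun A => odd #|` A| == c) h ->
  g * h = (-1) ^+ (b && c) *: (h * g).
Proof.
move=> Pg Ph; rewrite !gmul_expand exchange_big scaler_sumr /=.
rewrite !big_seq; apply: eq_bigr => B; rewrite -mcoeff_neq0 => /Ph/eqP oB.
rewrite scaler_sumr /= !big_seq; apply: eq_bigr => A.
rewrite -mcoeff_neq0 => /Pg/eqP oA; rewrite !gmonE fsetUC gscaleU.
congr << _ *g _ >>; rewrite gsignC -signr_odd oddM oA oB.
by rewrite (mulrC (g@_A)) mulrCA.
Qed.

Definition parity_part (b : bool) g : G :=
  \sum_(A <- msupp g | odd #|` A| == b) << g@_A *g A >>.

Lemma parity_part_supported b g :
  supported_in (fun A => odd #|` A| == b) (parity_part b g).
Proof. by apply: supported_in_sum => A; apply: supported_inU. Qed.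

Lemma parity_part_in P b g : supported_in P g -> supported_in P (parity_part b g).
Proof.
move=> Pg; rewrite /parity_part big_seq_cond; apply: supported_in_sum => A.
by rewrite -mcoeff_neq0 => /andP[/Pg PA _]; apply: supported_inU.
Qed.

Lemma parity_partE g : g = parity_part false g + parity_part true g.
Proof.
rewrite [LHS]monalgE (bigID (fun A => odd #|` A| == false)) /=; congr (_ + _).
by apply: eq_bigl => A; case: odd.
Qed.
End GrassmannParity.

Section GrassmannSplit.
Variable k : fieldType.
Local Notation G := (grassmann k).

Lemma grassmann_super (two_neq0 : 2%:R != 0 :> k) :
  super_split (@parity_part k false) (@parity_part k true).
Proof.
have odC (g h : G) : parity_part true g * parity_part true h =
    - (parity_part true h * parity_part true g).
  have := gmul_parity (@parity_part_supported _ true g)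
    (@parity_part_supported _ true h).
  by rewrite scaleN1r.
split=> [g|g h||g]; [exact: parity_partE | | exact: odC |].
- rewrite (parity_partE h); apply: commrD.
    have := gmul_parity (@parity_part_supported _ false g)
      (@parity_part_supported _ false h).
    by rewrite scale1r.
  have := gmul_parity (@parity_part_supported _ false g)
    (@parity_part_supported _ true h).
  by rewrite scale1r.
(* Anticommutation only says that twice the square vanishes; here 2 is invertible. *)
- have /eqP := odC g g; rewrite -addr_eq0 -mulr2n -scaler_nat.
  by rewrite scaler_eq0 (negbTE two_neq0) => /eqP.
Qed.

(** * Degree bounds in G(m) *)

Section TruncatedGrassmann.
Hypothesis two_neq0 : 2%:R != 0 :> k.
Variable m : nat.
Let sG := grassmann_super two_neq0.

Definition bounded (n : nat) : pred {fset nat} :=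
  fun A => all (fun a => a < m)%N A && (n <= #|` A|)%N.

Lemma boundedM n1 n2 (g h : G) : supported_in (bounded n1) g ->
  supported_in (bounded n2) h -> supported_in (bounded (n1 + n2)) (g * h).
Proof.
apply: supported_inM => A B /andP[/allP Am nA] /andP[/allP Bm nB] dAB.
apply/andP; split; first by apply/allP => a; rewrite !inE => /orP[/Am|/Bm].
by rewrite cardfsU (eqP dAB) cardfs0 subn0 leq_add.
Qed.

Lemma bounded_zero n (g : G) : (m < n)%N -> supported_in (bounded n) g -> g = 0.
Proof.
move=> mn gn; apply/malgP => A; rewrite mcoeff0; apply/eqP.
apply: contraTT mn => /gn/andP[/allP Am nA]; rewrite -leqNgt (leq_trans nA) //.
rewrite -[X in (_ <= X)%N](size_iota 0); apply: uniq_leq_size => // a /Am.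
by rewrite mem_iota.
Qed.

Lemma Gm1 : Gm k m 1. Proof. by move=> H [[H1 _ _] _]; apply/set_mem. Qed.

Lemma Gm_gen i : (i < m)%N -> Gm k m (gen k i).
Proof. by move=> im H [_ +]; apply; exists i. Qed.

Lemma GmZD a (g h : G) : Gm k m g -> Gm k m h -> Gm k m (a *: g + h).
Proof.
move=> Hg Hh H HH; have [[_ H2 _] _] := HH; apply/set_mem/H2; apply/mem_set.
  exact: Hg. exact: Hh.
Qed.

Lemma Gm0 : Gm k m 0.
Proof. by rewrite -(addNr 1) -scaleN1r; apply: GmZD; apply: Gm1. Qed.

Lemma GmM (g h : G) : Gm k m g -> Gm k m h -> Gm k m (g * h).
Proof.
move=> Hg Hh H HH; have [[_ _ H2] _] := HH; apply/set_mem/H2; apply/mem_set.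
  exact: Hg. exact: Hh.
Qed.

Lemma Gm_bounded (g : G) : Gm k m g -> supported_in (bounded 0) g.
Proof.
have bounded1 : supported_in (bounded 0) (1 : G) by apply: supported_inU.
apply; split=> [|_ [i im <-]]; last first.
  apply: supported_inU; rewrite /bounded andbT.
  by apply/allP => a; rewrite inE => /eqP->.
split; first exact/mem_set.
  move=> a g1 g2 /set_mem Hg1 /set_mem Hg2; apply/mem_set/supported_inD => //.
  exact: supported_inZ.
by move=> g1 g2 /set_mem Hg1 /set_mem Hg2; apply/mem_set/(@boundedM 0 0).
Qed.

Lemma lie_bounded (g h : G) : supported_in (bounded 0) g ->
  supported_in (bounded 0) h -> supported_in (bounded 2) (lie g h).
Proof.
have od1 (f : G) : supported_in (bounded 0) f ->
    supported_in (bounded 1) (parity_part true f).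
  move=> Hf A HA; have /eqP oA := parity_part_supported HA.
  have /andP[Am _] := parity_part_in Hf HA.
  by rewrite /bounded Am lt0n; case: #|` A| oA.
move=> Hg Hh; rewrite (super_lieE sG) -scaler_nat; apply: supported_inZ.
exact: (@boundedM 1 1 _ _ (od1 _ Hg) (od1 _ Hh)).
Qed.

Lemma lie_prod_bounded (v : nat -> G) r :
  (forall l, supported_in (bounded 0) (v l)) ->
  supported_in (bounded (size r)) (lie_prod v r).
Proof.
move=> Hv; elim/seq2_ind: r => [|a|a b r IHr] /=.
- exact: supported_inU.
- exact: supported_in0.
- by apply: (@boundedM 2); [exact: lie_bounded |].
Qed.

Lemma prod_gen_neq0 n : \prod_(i <- iota 0 n) gen k i != 0.
Proof. by rewrite prod_gen ?iota_ltn_sorted // monalgU_eq0 oner_eq0. Qed.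

(** The commutator of [g] and [h] has only terms of degree at least 2, and [lie_prod v r] of degree
    at least [size r]; their product exceeds the top degree m. *)
Lemma lie_prod_top_central r (v : nat -> G) : (m < (size r).+2)%N ->
    ~~ odd (size r) -> (forall l, Gm k m (v l)) ->
  forall g h, Gm k m g -> Gm k m h ->
    g * lie_prod v r * h = h * (g * lie_prod v r).
Proof.
move=> mr er Hv g h Hg Hh; apply/eqP; rewrite -subr_eq0.
rewrite -mulrA (super_lie_prod_central sG) !mulrA -mulrBl; apply/eqP.
apply: (bounded_zero mr); rewrite -addn2 addnC; apply: boundedM.
  by apply: lie_bounded; apply: Gm_bounded.
by apply: lie_prod_bounded => l; apply: Gm_bounded.
Qed.

End TruncatedGrassmann.
End GrassmannSplit.

(** * The free algebra *)

(** The principle [ind] says that the [W s] span A; both sides are additive in each factor, so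
    checking multiples of the [W s] suffices. *)
Lemma scaleAr_of_basis (k : fieldType) (A : lalgType k) (T : Type) (W : T -> A)
    (ind : forall P : A -> Prop, P 0 ->
       (forall a s f, P f -> P (a *: W s + f)) -> forall f, P f)
    (WZ : forall a b c s t,
       a *: ((b *: W s) * (c *: W t)) = (b *: W s) * (a *: (c *: W t))) :
  forall a (f g : A), a *: (f * g) = f * (a *: g).
Proof.
move=> a f g; elim/ind: g => [|c t g IHg]; first by rewrite scaler0 mulr0 scaler0.
rewrite mulrDr !scalerDr mulrDr IHg; congr (_ + _).
elim/ind: f {g IHg} => [|b s f IHf]; first by rewrite !mul0r scaler0.
by rewrite mulrDl scalerDr mulrDl IHf WZ.
Qed.

Section FreeAlgebra.
Variable k : fieldType.
Local Notation F := (freealg k).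

Lemma monalg_scale (K : choiceType) (R : nzRingType) (a b : R) (x : K) :
  a *: << b *g x >> = << a * b *g x >> :> {malg R[K]}.
Proof.
apply/malgP => y; rewrite mcoeffZ [in LHS]mcoeffU [in RHS]mcoeffU.
exact/mulrnAr.
Qed.

(* [letter l] is the variable x_(l+1), that is [var k l.+1]. *)
Definition letter (l : nat) : F := << fmu l >>.
Definition word (s : seq nat) : F := \prod_(l <- s) letter l.

Lemma malg_word (w : {fmonom nat}) : << w >> = word w.
Proof.
case: w => s; rewrite /word /=; elim: s => [|l s IHs].
  by rewrite big_nil; congr << _ >>; apply/eqP; rewrite fmP /= fm1.
rewrite big_cons -IHs /letter malgME !msuppU1 !big_seq_fset1 !mcoeffUU mulr1.
by congr << _ >>; apply/eqP; rewrite fmP /= fmM fmuE.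
Qed.

Lemma free_expand (f : F) : f = \sum_(w <- msupp f) f@_w *: word w.
Proof.
rewrite [LHS]monalgE; apply: eq_bigr => w _.
by rewrite -malg_word monalg_scale mulr1.
Qed.

(** The universal property. By [scaleAr] scalars commute with the values, which makes [mmap]
    multiplicative. *)
Lemma free_morphism (A : lalgType k)
    (scaleAr : forall a (x y : A), a *: (x * y) = x * (a *: y)) (v : nat -> A) :
  exists phi : {lrmorphism F -> A}, forall l, phi (letter l) = v l.
Proof.
pose h (w : {fmonom nat}) := \prod_(l <- w) v l.
have hM : mmorphism h.
  by split=> [w w'|]; rewrite /h ?fmM ?big_cat // fm1 big_nil.
pose H : {mmorphism {fmonom nat} -> A} := HB.pack h (isMultiplicative.Build _ _ h hM).
pose phi : F -> A := mmap (in_alg A) H.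
have phiM : multiplicative phi.
  apply: commr_mmap_is_multiplicative => g w w'.
  by rewrite /GRing.comm /= mulr_algl -scaleAr mulr1.
have phiZ : scalable phi by move=> a g; rewrite /phi mmapZ mulr_algl.
pose Phi : {lrmorphism F -> A} := HB.pack phi
  (GRing.isAdditive.Build _ _ phi (@mmap_is_additive _ _ _ (in_alg A) H))
  (GRing.isMultiplicative.Build _ _ phi phiM)
  (GRing.isScalable.Build _ _ _ _ phi phiZ).
exists Phi => l.
by rewrite /= /phi /letter mmapU /= scale1r mul1r /h fmuE big_seq1.
Qed.

Lemma free_ind (P : F -> Prop) :
    P 0 -> (forall a s f, P f -> P (a *: word s + f)) -> forall f, P f.
Proof.
move=> P0 PD f; rewrite (free_expand f).
by elim/big_rec: _ => // w g _; apply: PD.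
Qed.

Lemma word_monom (s : seq nat) : word s = << fmonom_of_seq fmonom_key s >>.
Proof. by rewrite malg_word fmE. Qed.

Lemma mcoeff_word (s : seq nat) (w : {fmonom nat}) :
  (word s)@_w = (s == w :> seq nat)%:R.
Proof. by rewrite word_monom mcoeffU1 fmP fmE. Qed.

Lemma wordZM (a b : k) (s t : seq nat) :
  (a *: word s) * (b *: word t) = (a * b) *: word (s ++ t).
Proof.
rewrite !word_monom !monalg_scale !malgM_def fgmulUU !mulr1.
congr << _ *g _ >>.
by apply/eqP; rewrite fmP fmM !fmE.
Qed.

Lemma free_scaleAr (a : k) (f g : F) : a *: (f * g) = f * (a *: g).
Proof.
apply: (scaleAr_of_basis free_ind) => {}a b c s t.
by rewrite (scalerA a c (word t)) !wordZM (scalerA a (b * c)) (mulrCA a b).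
Qed.

Lemma free_morphism_eq0 (A : lalgType k) (phi : {lrmorphism F -> A}) :
  (forall l, phi (letter l) = 0) -> forall f, phi f = f@_mone *: 1.
Proof.
move=> phi0; elim/free_ind => [|a s f IHf].
  by rewrite raddf0 mcoeff0 scale0r.
rewrite raddfD /= linearZ /= IHf mcoeffD mcoeffZ scalerDl; congr (_ + _).
rewrite rmorph_prod mcoeff_word fm1; case: s => [|l s].
  by rewrite big_nil mulr1.
by rewrite big_cons /= phi0 mul0r scaler0 mulr0 scale0r.
Qed.

(** * Evaluations in G(m) and its identities *)

Section TIdeal.
Variable m : nat.

Lemma into_Gm_letters (phi : {lrmorphism F -> grassmann k}) :
  (forall l, Gm k m (phi (letter l))) -> into_Gm m phi.
Proof.
move=> Hphi f; elim/free_ind: f => [|a s f IHf].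
  by rewrite raddf0; apply: Gm0.
rewrite raddfD /= linearZ; apply: GmZD => //=; rewrite rmorph_prod.
elim: s => [|l s IHs]; first by rewrite big_nil; apply: Gm1.
by rewrite big_cons; apply: GmM; [apply: Hphi | apply: IHs].
Qed.

Lemma Gm_evaluation (v : nat -> grassmann k) : (forall l, Gm k m (v l)) ->
  exists2 phi : {lrmorphism F -> grassmann k},
    into_Gm m phi & forall l, phi (letter l) = v l.
Proof.
move=> Hv; have [phi phiE] := free_morphism (@gscaleAr k) v.
by exists phi => //; apply: into_Gm_letters => l; rewrite phiE.
Qed.

(** Evaluation at zero has values in G(m) and returns the constant term. *)
Lemma TGP f : TG k m f <-> forall phi, into_Gm m phi -> phi f = 0.
Proof.
split=> [[]//|Hf]; split=> //.
have [|phi Hphi phi0] := @Gm_evaluation (fun=> 0).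
  by move=> _; apply: Gm0.
have /eqP := Hf phi Hphi; rewrite free_morphism_eq0 // scaler_eq0 oner_eq0 orbF.
by move=> /eqP.
Qed.

End TIdeal.
End FreeAlgebra.

(** * Multihomogeneous components *)

Section Components.
Variables (k : fieldType) (L : lmodType k) (V : L -> Prop).
Hypothesis V0 : V 0.
Hypothesis VD : forall f g, V f -> V g -> V (f + g).
Hypothesis VZ : forall a f, V f -> V (a *: f).

Lemma subspace_sum I (r : seq I) (P : pred I) (f : I -> L) :
  (forall i, P i -> V (f i)) -> V (\sum_(i <- r | P i) f i).
Proof. by move=> Vf; elim/big_ind: _. Qed.

(** Evaluation at n distinct scalars gives a Vandermonde system, whose inverse expresses each [v d]
    through the values. *)
Lemma coefficient_in_subspace n (v : 'I_n -> L) : infinite_set [set: k] ->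
  (forall t : k, V (\sum_(d < n) t ^+ d *: v d)) -> forall d, V (v d).
Proof.
move=> /(infinite_set_fset n)[B _ nB] Vv d.
pose a := \row_(j < n) nth 0 (B : seq k) j.
have a_inj i j : a 0 i = a 0 j -> i = j.
  rewrite !mxE => /eqP; rewrite nth_uniq ?fset_uniq ?(leq_trans _ nB) //.
  by move/eqP/val_inj.
have unitV : Vandermonde n a \in unitmx.
  rewrite unitmxE det_Vandermonde unitfE; apply/prodf_neq0 => i _.
  apply/prodf_neq0 => j ij; rewrite subr_eq0; apply: contraTneq ij => /a_inj->.
  by rewrite ltnn.
pose C := invmx (Vandermonde n a).
have -> : v d = \sum_j C j d *: \sum_(e < n) a 0 j ^+ e *: v e.
  transitivity (\sum_(e < n) (Vandermonde n a *m C) e d *: v e).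
    rewrite mulmxV // (bigD1 d) //= mxE eqxx scale1r big1 ?addr0 // => e ed.
    by rewrite mxE (negbTE ed) scale0r.
  under [RHS]eq_bigr do rewrite scaler_sumr.
  rewrite exchange_big; apply: eq_bigr => e _.
  rewrite mxE scaler_suml; apply: eq_bigr => j _.
  by rewrite scalerA [Vandermonde _ _ _ _]mxE mulrC.
by apply: subspace_sum => j _; apply: VZ.
Qed.

Lemma sum_by_degree (T : eqType) (r : seq T) (c : T -> nat) n (a : nat -> k)
    (g : T -> L) : {in r, forall w, (c w < n)%N} ->
  \sum_(w <- r) a (c w) *: g w =
  \sum_(d < n) a d *: \sum_(w <- r | c w == d) g w.
Proof.
move=> cn; under [RHS]eq_bigr do rewrite scaler_sumr big_mkcond.
rewrite exchange_big; apply: eq_big_seq => w /cn cwn.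
rewrite (bigD1 (Ordinal cwn)) //= eqxx big1 ?addr0 // => d dw.
by rewrite ifN // eq_sym; apply: contraNneq dw => dE; apply/eqP/val_inj.
Qed.

Lemma sum_by_degree1 (T : eqType) (r : seq T) (c : T -> nat) n (g : T -> L) :
    {in r, forall w, (c w < n)%N} ->
  \sum_(w <- r) g w = \sum_(d < n) \sum_(w <- r | c w == d) g w.
Proof.
move=> /(sum_by_degree (fun=> 1) g) E.
transitivity (\sum_(w <- r) 1 *: g w); first by apply: eq_bigr => w; rewrite scale1r.
by rewrite E; apply: eq_bigr => d _; rewrite scale1r.
Qed.
End Components.

Lemma dilate_prod (k : fieldType) (A : lalgType k)
    (scaleAr : forall a (x y : A), a *: (x * y) = x * (a *: y))
    (X : nat -> A) (i : nat) (t : k) s :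
  \prod_(l <- s) (if l == i then t *: X l else X l) =
  t ^+ count_mem i s *: \prod_(l <- s) X l.
Proof.
elim: s => [|l s IHs]; first by rewrite !big_nil scale1r.
rewrite !big_cons IHs /=; case: eqP => _ /=; last by rewrite scaleAr.
by rewrite -scaleAr -scalerAl scalerA exprSr.
Qed.

Section Multihomogeneous.
Variable k : fieldType.
Local Notation F := (freealg k).
Hypothesis k_infinite : infinite_set [set: k].

Definition letter_component (i d : nat) (f : F) : F :=
  \sum_(w <- msupp f | count_mem i w == d) f@_w *: word k w.

Lemma msupp_letter_component i d f w : w \in msupp (letter_component i d f) ->
  w \in msupp f /\ count_mem i w = d.
Proof.
rewrite -!mcoeff_neq0 raddf_sum /= => w0.
have [] := boolP ((w \in msupp f) && (count_mem i w == d)).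
  by rewrite -mcoeff_neq0 => /andP[-> /eqP->].
move=> wN; case/eqP: w0; rewrite big_seq_cond big1 // => u uP.
rewrite mcoeffZ mcoeff_word; case: eqP => [uw|]; last by rewrite mulr0.
have {}uw : u = w by apply/eqP; rewrite fmP uw.
by rewrite -uw uP in wN.
Qed.

Variables V W : F -> Prop.
Hypothesis V0 : V 0.
Hypothesis VD : forall f g, V f -> V g -> V (f + g).
Hypothesis VZ : forall a f, V f -> V (a *: f).
Hypothesis V_dilate : forall (phi : {lrmorphism F -> F}),
  (forall l, exists t, phi (letter k l) = t *: letter k l) ->
  forall f, V f -> V (phi f).

(** Replacing x_i by t x_i multiplies the component of degree e by t^e. Closure is asked for
    dilations and not for all endomorphisms, since the latter may create constant terms. *)
Lemma letter_component_in i d f : V f -> V (letter_component i d f).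
Proof.
move=> Vf; pose n := (\max_(w <- msupp f) count_mem i w).+1.
have cn (w : {fmonom nat}) : w \in msupp f -> (count_mem i w < n)%N.
  move=> wf; rewrite ltnS.
  exact: (@leq_bigmax_seq _ _ xpredT (fun w : {fmonom nat} => count_mem i w)).
have [dn|nd] := ltnP d n; last first.
  rewrite /letter_component big_seq_cond big1 => [|w /andP[/cn wn /eqP wd]].
    exact: V0.
  by rewrite wd ltnNge nd in wn.
apply: (coefficient_in_subspace V0 VD VZ
  (v := fun e : 'I_n => letter_component i e f) k_infinite _ (Ordinal dn)) => t.
have [phi phiE] := free_morphism (@free_scaleAr k)
  (fun l => if l == i then t *: letter k l else letter k l).
have := V_dilate (phi := phi) _ Vf.
suff <- : phi f = \sum_(e < n) t ^+ e *: letter_component i e f.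
  apply=> l; rewrite phiE; case: eqP => _; first by exists t.
  by exists 1; rewrite scale1r.
rewrite -(sum_by_degree (fun e => t ^+ e)
  (fun w : {fmonom nat} => f@_w *: word k w) cn).
rewrite {1}(free_expand f) raddf_sum; apply: eq_bigr => w _.
rewrite /= linearZ /= rmorph_prod scalerA mulrC -scalerA; congr (_ *: _).
rewrite -dilate_prod; last exact: free_scaleAr.
by apply: eq_bigr => l _; apply: phiE.
Qed.

Hypothesis W0 : W 0.
Hypothesis WD : forall f g, W f -> W g -> W (f + g).

(** Induction on a list [l] outside which all monomials of f agree in their multiplicities,
    beginning with all letters of f; each step splits f by its degree in one letter. *)
Lemma multihomogeneous_reduction :
    (forall f, V f -> (forall w w', w \in msupp f -> w' \in msupp f ->
       perm_eq (w : seq nat) w') -> W f) ->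
  forall f, V f -> W f.
Proof.
move=> HW f Vf.
pose l := flatten [seq (w : seq nat) | w : {fmonom nat} <- msupp f].
have fl : forall w w', w \in msupp f -> w' \in msupp f ->
    forall i, i \notin l -> count_mem i w = count_mem i w'.
  have c0 (w : {fmonom nat}) i : w \in msupp f -> i \notin l -> count_mem i w = 0%N.
    move=> wf; apply: contraNeq; rewrite -lt0n -has_count has_pred1 => iw.
    by apply/flattenP; exists (w : seq nat) => //; apply/mapP; exists w.
  by move=> w w' wf w'f i il; rewrite !c0.
clearbody l; move: l f Vf fl; elim=> [|i l IHl] f Vf fl.
  apply: HW => // w w' wf w'f; apply/allP => i _ /=.
  by apply/eqP/fl.
pose n := (\max_(w <- msupp f) count_mem i w).+1.
have cn (w : {fmonom nat}) : w \in msupp f -> (count_mem i w < n)%N.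
  move=> wf; rewrite ltnS.
  exact: (@leq_bigmax_seq _ _ xpredT (fun w : {fmonom nat} => count_mem i w)).
have -> : f = \sum_(d < n) letter_component i d f.
  rewrite [LHS]free_expand.
  exact: (sum_by_degree1 (fun w : {fmonom nat} => f@_w *: word k w) cn).
elim/big_ind: _ => // d _; apply: IHl; first exact: letter_component_in.
move=> w w' /msupp_letter_component[wf wd] /msupp_letter_component[w'f w'd] j jl.
have [->|ji] := eqVneq j i; first by rewrite wd w'd.
by apply: fl => //; rewrite inE negb_or ji.
Qed.
End Multihomogeneous.

(** * T-spaces and their generators *)

Section TSpaces.
Variable k : fieldType.
Local Notation F := (freealg k).
Implicit Types A B : set F.

Lemma is_tspaceP A : is_tspace A <->
  [/\ A 0, forall f g, A f -> A g -> A (f + g), forall a f, A f -> A (a *: f)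
    & forall (phi : {lrmorphism F -> F}) f, A f -> A (phi f)].
Proof.
split=> [[[A0 AZD] Aphi]|[A0 AD AZ Aphi]].
  have {}A0 : A 0 by apply/set_mem.
  have {}AZD a f g : A f -> A g -> A (a *: f + g).
    by move=> Af Ag; apply/set_mem/AZD; apply/mem_set.
  split=> // [f g Af Ag|a f Af]; first by rewrite -[f]scale1r; apply: AZD.
  by rewrite -[a *: f]addr0; apply: AZD.
split=> //; split; first exact/mem_set.
by move=> a f g /set_mem Af /set_mem Ag; apply/mem_set/AD => //; apply: AZ.
Qed.

Lemma tspace_gen_tspace A : is_tspace (tspace_gen A).
Proof.
apply/is_tspaceP; split=> [B|f g Hf Hg B|a f Hf B|phi f Hf B] HB;
  have [/is_tspaceP[B0 BD BZ Bphi] _] := HB => //.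
- by apply: BD; [apply: Hf | apply: Hg].
- by apply: BZ; apply: Hf.
- by apply: Bphi; apply: Hf.
Qed.

Lemma sub_tspace_gen A : A `<=` tspace_gen A.
Proof. by move=> f Af B [_]; apply. Qed.

Lemma tspace_gen_min A B : is_tspace B -> A `<=` B -> tspace_gen A `<=` B.
Proof. by move=> HB AB f; apply. Qed.

Lemma sumset_tspace A B : is_tspace A -> is_tspace B -> is_tspace (sumset A B).
Proof.
move=> /is_tspaceP[A0 AD AZ Aphi] /is_tspaceP[B0 BD BZ Bphi].
apply/is_tspaceP; split.
- by exists 0 => //; exists 0 => //; rewrite addr0.
- move=> _ _ [f Af [g Bg <-]] [f' Af' [g' Bg' <-]].
  by exists (f + f'); [exact: AD | exists (g + g'); [exact: BD | rewrite addrACA]].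
- move=> a _ [f Af [g Bg <-]].
  by exists (a *: f); [exact: AZ | exists (a *: g); [exact: BZ | rewrite scalerDr]].
- move=> phi _ [f Af [g Bg <-]].
  by exists (phi f); [exact: Aphi | exists (phi g); [exact: Bphi | rewrite raddfD]].
Qed.

Lemma sumset_subl A B : is_tspace B -> A `<=` sumset A B.
Proof.
by move=> /is_tspaceP[B0 _ _ _] f Af; exists f => //; exists 0 => //; rewrite addr0.
Qed.

Lemma sumset_subr A B : is_tspace A -> B `<=` sumset A B.
Proof.
by move=> /is_tspaceP[A0 _ _ _] f Bf; exists 0 => //; exists f => //; rewrite add0r.
Qed.

Lemma sumset_min A B C : is_tspace C -> A `<=` C -> B `<=` C -> sumset A B `<=` C.
Proof.
by move=> /is_tspaceP[_ CD _ _] AC BC _ [f /AC Cf [g /BC Cg <-]]; apply: CD.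
Qed.

Lemma into_Gm_comp m (phi : {lrmorphism F -> grassmann k})
    (psi : {lrmorphism F -> F}) :
  into_Gm m phi -> into_Gm m (phi \o psi).
Proof. by move=> H f; apply: H. Qed.

Lemma TG_tspace m : is_tspace (TG k m).
Proof.
apply/is_tspaceP; split; last first.
- move=> psi f /TGP Hf; apply/TGP => phi Hphi.
  exact: (Hf _ (into_Gm_comp psi Hphi)).
- by move=> a f /TGP Hf; apply/TGP => phi Hphi; rewrite linearZ /= Hf // scaler0.
- move=> f g /TGP Hf /TGP Hg; apply/TGP => phi Hphi.
  by rewrite raddfD /= Hf // Hg // addr0.
- by apply/TGP => phi _; rewrite raddf0.
Qed.

Lemma S1_tspace p : is_tspace (S1 k p).
Proof.
rewrite /S1; case: ifP => _; first exact: tspace_gen_tspace.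
by apply: sumset_tspace; apply: tspace_gen_tspace.
Qed.

Lemma S1m_tspace p m : is_tspace (S1m k p m).
Proof. by apply: sumset_tspace; [exact: S1_tspace | exact: tspace_gen_tspace]. Qed.

Lemma commutator_in_S1 p : S1 k p (lie (letter k 0) (letter k 1)).
Proof.
rewrite /S1; case: ifP => _; first by apply: sub_tspace_gen.
by apply: (sumset_subl (tspace_gen_tspace _)); apply: sub_tspace_gen => /=; left.
Qed.

Lemma power_in_S1 p : (0 < p)%N -> S1 k p (letter k 0 ^+ p).
Proof.
rewrite /S1; case: p => // p _ /=.
by apply: (sumset_subl (tspace_gen_tspace _)); apply: sub_tspace_gen => /=; right.
Qed.

Lemma wpoly_in_S1 p n : (0 < p)%N -> (0 < n)%N ->
  S1 k p (letter k n.*2 ^+ p * wpoly k p n).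
Proof.
have varE : var k (2 * n + 1) = letter k n.*2.
  by congr (letter k _); rewrite addn1 mul2n.
rewrite /S1 -varE; case: p => // p _ n0.
apply: (sumset_subr (tspace_gen_tspace _)); apply: sub_tspace_gen.
exact: (ex_intro2 _ _ n n0 erefl).
Qed.

Lemma hpolyE j : hpoly k j = lie_prod (letter k) (iota 0 j.*2).
Proof. exact: lie_prod_iota. Qed.

(** Here b_m - 1 is m/2 rounded down, and the variable in front is the first letter that the
    commutators leave free. *)
Lemma top_generatorE m : var k (2 * bnum m - 1) * hpoly k (bnum m - 1) =
  letter k m./2.*2 * lie_prod (letter k) (iota 0 m./2.*2).
Proof.
have -> : var k (2 * bnum m - 1) = letter k m./2.*2.
  by congr (letter k _); rewrite /bnum; lia.
have -> : (bnum m - 1 = m./2)%N by rewrite /bnum subn1.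
by rewrite hpolyE.
Qed.

Lemma top_in_S1m p m :
  S1m k p m (letter k m./2.*2 * lie_prod (letter k) (iota 0 m./2.*2)).
Proof.
apply: (sumset_subr (S1_tspace _)); apply: sub_tspace_gen.
by rewrite -top_generatorE.
Qed.

Lemma S1_sub_S1m p m : S1 k p `<=` S1m k p m.
Proof. exact: (sumset_subl (tspace_gen_tspace _)). Qed.

Lemma half_bounds m : (m./2.*2 <= m < m./2.*2.+2)%N.
Proof. by rewrite -[X in (_ <= X < _)%N](odd_double_half m); case: odd; lia. Qed.

(** * The generators of S_1(m) have central values *)

Section Central.
Variables (p m : nat).
Hypothesis two_neq0 : 2%:R != 0 :> k.
Hypothesis p_eq0 : (0 < p)%N -> p%:R = 0 :> k.
Let sG := grassmann_super two_neq0.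

Definition central_valued : set F :=
  [set f | forall phi, into_Gm m phi -> Gm_center k m (phi f)].

Lemma central_valued_tspace : is_tspace central_valued.
Proof.
apply/is_tspaceP; split.
- move=> phi _; rewrite raddf0.
  by split; [exact: Gm0 | move=> y _; rewrite mul0r mulr0].
- move=> f g Hf Hg phi Hphi; split; first exact: Hphi.
  move=> y Hy; rewrite raddfD /=; apply/esym/commrD; apply/esym.
    exact: (Hf phi Hphi).2.
  exact: (Hg phi Hphi).2.
- move=> a f Hf phi Hphi; split; first exact: Hphi.
  by move=> y Hy; rewrite linearZ /= -gscaleAl -gscaleAr (Hf phi Hphi).2.
- by move=> psi f Hf phi Hphi; apply: (Hf _ (into_Gm_comp psi Hphi)).
Qed.

Lemma TG_central_valued : TG k m `<=` central_valued.
Proof.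
move=> f /TGP Hf phi Hphi; split; first exact: Hphi.
by move=> y _; rewrite (Hf phi Hphi) mul0r mulr0.
Qed.

(** The union of the central polynomials and the identities, which unlike the former is a
    subspace. *)
Definition central_or_identity : set F := [set f | central_valued f /\ nonunitary f].

Lemma nonunitaryP f : (forall phi : {lrmorphism F -> grassmann k},
  (forall l, phi (letter k l) = 0) -> phi f = 0) -> nonunitary f.
Proof.
have [phi phi0] := free_morphism (@gscaleAr k) (fun=> 0).
move=> /(_ phi phi0) /eqP; rewrite free_morphism_eq0 // scaler_eq0 oner_eq0 orbF.
by move=> /eqP.
Qed.

Lemma commutator_central : central_or_identity (lie (letter k 0) (letter k 1)).
Proof.
split=> [phi Hphi|]; last first.
  by apply: nonunitaryP => phi phi0; rewrite rmorph_lie /= !phi0 /lie mul0r subrr.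
split=> [|y _]; first exact: Hphi.
by rewrite rmorph_lie (super_lie_central sG).
Qed.

Let pG : (0 < p)%N -> p%:R = 0 :> grassmann k.
Proof. by move=> /p_eq0 p0; rewrite -scaler_nat p0 scale0r. Qed.

Lemma power_central : (0 < p)%N -> central_or_identity (letter k 0 ^+ p).
Proof.
move=> p0; split=> [phi Hphi|]; last first.
  by apply: nonunitaryP => phi phi0; rewrite rmorphXn /= phi0 expr0n; case: p p0.
split=> [|y _]; first exact: Hphi.
by rewrite rmorphXn /= (super_expr_central sG) // pG.
Qed.

Lemma rmorph_wpoly (phi : {lrmorphism F -> grassmann k}) n :
  phi (wpoly k p n) = word_lie (phi \o letter k)
    (flatten [seq nseq p.-1 l | l <- iota 0 n.*2]) (iota 0 n.*2).
Proof.
rewrite /word_lie -(super_wprodE sG); exact: rmorph_wprod.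
Qed.

Lemma wpoly_central n : (0 < p)%N ->
  central_or_identity (letter k n.*2 ^+ p * wpoly k p n).
Proof.
move=> p0; split=> [phi Hphi|]; last first.
  apply: nonunitaryP => phi phi0; rewrite rmorphM rmorphXn /= phi0 expr0n.
  by case: p p0 => //= *; rewrite mul0r.
split=> [|y _]; first exact: Hphi.
rewrite rmorphM rmorphXn /= rmorph_wpoly; apply: commuting_mul.
  by apply: (super_expr_central sG); apply: pG.
apply: (super_word_lie_central sG) => l.
by move=> /flattenP[_ /mapP[x xn ->]]; rewrite mem_nseq => /andP[_ /eqP->].
Qed.

Lemma top_generator_central :
  central_or_identity (letter k m./2.*2 * lie_prod (letter k) (iota 0 m./2.*2)).
Proof.
split=> [phi Hphi|]; last first.
  by apply: nonunitaryP => phi phi0; rewrite rmorphM /= phi0 mul0r.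
split=> [|y Hy]; first exact: Hphi.
rewrite rmorphM rmorph_lie_prod.
apply: (lie_prod_top_central two_neq0 _ _ _ (Hphi _) Hy).
- by rewrite size_iota; case/andP: (half_bounds m).
- by rewrite size_iota odd_double.
- by move=> l; apply: Hphi.
Qed.

(** With distinct generators in the commutators and 1 for the variable in front, the value is a
    power of 2 times a basis element. *)
Lemma top_not_identity : (0 < m)%N ->
  ~ TG k m (letter k m./2.*2 * lie_prod (letter k) (iota 0 m./2.*2)).
Proof.
move=> m0 /TGP; set q := m./2.*2.
have qm : (q <= m)%N by case/andP: (half_bounds m).
have [|phi Hphi phiE] :=
  @Gm_evaluation k m (fun l => if (l < q)%N then gen k l else 1).
  move=> l; case: ifP => lq; last exact: Gm1.
  by apply: Gm_gen; apply: leq_trans lq qm.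
move=> /(_ phi Hphi)/eqP; apply/negP.
rewrite rmorphM rmorph_lie_prod /= phiE ltnn mul1r.
have -> : lie_prod (phi \o letter k) (iota 0 q) = lie_prod (gen k) (iota 0 q).
  by apply: eq_in_lie_prod => l; rewrite mem_iota add0n /= phiE => ->.
rewrite anticommuting_lie_prod; last by rewrite size_iota odd_double.
  rewrite -scaler_nat scaler_eq0 negb_or natrX expf_neq0 //=.
  exact: prod_gen_neq0.
by move=> a b _ _; apply: gen_anticomm.
Qed.

End Central.
End TSpaces.

(** * Multiplicities of letters *)

Lemma exists_count (S : seq nat) (c : nat -> nat) :
  (forall l, l \notin S -> c l = 0%N) -> exists y, forall l, count_mem l y = c l.
Proof.
move=> cS; exists (flatten [seq nseq (c l) l | l <- undup S]) => l.
rewrite count_flatten -map_comp.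
have -> : [seq (count_mem l \o (fun x => nseq (c x) x)) x | x <- undup S] =
          [seq ((x == l) * c l)%N | x <- undup S].
  by apply: eq_map => x /=; rewrite count_nseq /=; case: eqP => [->|].
have [lS|lS] := boolP (l \in S); last first.
  by rewrite (cS l lS) sumnE big_map big1 // => x _; rewrite muln0.
rewrite sumnE big_map (bigD1_seq l) ?mem_undup ?undup_uniq //=.
rewrite eqxx mul1n big1 ?addn0 //.
by move=> x /negbTE->.
Qed.

Lemma perm_count_mem (s t : seq nat) :
  (forall l, count_mem l s = count_mem l t) -> perm_eq s t.
Proof. by move=> st; apply/allP => l _; apply/eqP/st. Qed.

(** A letter of [r] occurs once there, so by divisibility at least p - 1 times in [s]; once these
    are removed, all multiplicities in [s] are divisible by p. *)
Lemma perm_pth_power (p : nat) (s r : seq nat) : (0 < p)%N -> uniq r ->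
    (forall l, (p %| count_mem l (s ++ r))%N) ->
  exists y, perm_eq s (flatten (nseq p y) ++ flatten [seq nseq p.-1 l | l <- r]).
Proof.
move=> p0 ur psr.
have [|y yE] := @exists_count (s ++ r)
  (fun l => count_mem l (s ++ r) %/ p - count_mem l r)%N.
  by move=> l /count_memPn->; rewrite div0n.
exists y; apply: perm_count_mem => l; rewrite count_cat !count_flatten.
rewrite map_nseq sumn_nseq -map_comp yE.
have -> : sumn [seq (count_mem l \o [eta nseq p.-1]) x | x <- r] =
          (p.-1 * count_mem l r)%N.
  elim: (r) => [|x t IHt] /=; first by rewrite muln0.
  by rewrite IHt count_nseq /= mulnDr mulnC.
have /dvdnP[e eE] := psr l; rewrite eE mulnK //.
move: eE; rewrite count_cat (count_uniq_mem _ ur); case: (l \in r) => /=; last by lia.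
case: e => [|e]; first by lia.
by rewrite mulSn subn1 muln1 /=; lia.
Qed.

(** * Coefficients of central polynomials *)

Section AnticommutingFamily.
Variables (R : pzRingType) (u : nat -> R).
Hypothesis uC : forall a b, u a * u b = - (u b * u a).
Hypothesis u2 : forall a, u a * u a = 0.

(** In the word, the letters of [r] become 1 because the commutators kill their odd parts, and (1 +
    u_i)^d is 1 + d u_i because u_i has square zero. *)
Lemma anticommuting_word_lie i s r : ~~ odd (size r) ->
    (forall l, l \in s -> l \notin i :: r -> u l = 0) ->
  word_lie (fun l => 1 + u l) s r = (1 + u i *+ count_mem i s) * lie_prod u r.
Proof.
move=> er; rewrite /word_lie lie_prod_add1; set L := lie_prod u r.
have uL l : l \in r -> u l * L = 0.
  move=> lr; rewrite /L (anticommuting_lie_prod (in2W uC) er).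
  by rewrite mulrnAr anticommuting_prod0 // mul0rn.
elim: s => [|l s IHs] us; first by rewrite big_nil addr0.
rewrite big_cons -mulrA IHs => [|x xs]; last by apply: us; rewrite inE xs orbT.
rewrite [LHS]mulrDl mul1r /=.
have [->|li] := eqVneq l i.
  rewrite (mulrA (u i)) mulrDr mulr1 mulrnAr u2 mul0rn addr0 -mulrDl.
  by rewrite -addrA -mulrSr.
suff -> : u l * ((1 + u i *+ count_mem i s) * L) = 0 by rewrite addr0.
have [lr|lr] := boolP (l \in r); last first.
  by rewrite us ?mem_head ?inE ?negb_or ?li // mul0r.
rewrite mulrDl mul1r mulrDr uL // add0r mulrnAl mulrnAr mulrA uC mulNr -mulrA uL //.
by rewrite mulr0 oppr0 mul0rn.
Qed.

Lemma prod_consE i r : u i * \prod_(l <- r) u l = \prod_(l <- i :: r) u l.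
Proof. by rewrite big_cons. Qed.
End AnticommutingFamily.

Lemma map_index_uniq (t : seq nat) : uniq t ->
  [seq index l t | l <- t] = iota 0 (size t).
Proof.
move=> ut; apply: (@eq_from_nth _ 0%N); first by rewrite size_map size_iota.
rewrite size_map => j jt; rewrite (nth_map 0%N) // nth_iota //.
by rewrite index_uniq.
Qed.

(** Since [g] commutes with [L] and anticommutes with [x], its commutator with (1 + d x) L is 2 d x
    L g up to sign. *)
Lemma central_anticommuting (k : fieldType) (A : algType k) (c : k) (d : nat)
    (x g L : A) : g * L = L * g -> x * g = - (g * x) ->
    c *: ((1 + x *+ d) * L) * g = g * (c *: ((1 + x *+ d) * L)) ->
  c *: (x * L * g) *+ (2 * d) = 0.
Proof.
move=> gL xg; rewrite -scalerAl -scalerAr => /eqP; rewrite -subr_eq0 -scalerBr.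
have xLg : x * L * g = - (g * x * L) by rewrite -mulrA -gL mulrA xg mulNr.
suff -> : (1 + x *+ d) * L * g - g * ((1 + x *+ d) * L) = x * L * g *+ (2 * d).
  by rewrite -scalerMnr => /eqP.
rewrite mulrDl mul1r mulrDl mulrDr gL opprD addrACA subrr add0r.
by rewrite !mulrnAl mulrnAr mulrA -mulNrn -xLg -mulrnDr mul2n addnn.
Qed.

Lemma linear_single (k : fieldType) (L A : lmodType k) (phi : {linear L -> A})
    (T : eqType) (S : seq T) (c : T -> k) (N : T -> L) i :
    uniq S -> i \in S ->
    (forall j, j \in S -> j != i -> c j = 0 \/ phi (N j) = 0) ->
  phi (\sum_(j <- S) c j *: N j) = c i *: phi (N i).
Proof.
move=> uS iS H; rewrite raddf_sum (bigD1_seq i) //= linearZ /=.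
rewrite big_seq_cond big1 ?addr0 // => j /andP[jS ji]; rewrite linearZ /=.
by have [->|->] := H j jS ji; rewrite ?scale0r ?scaler0.
Qed.

Definition rest (b r : seq nat) := foldl (fun s x => rem x s) b r.

Lemma rest_perm b r : uniq r -> {subset r <= b} -> perm_eq (rest b r ++ r) b.
Proof.
elim: r b => [|x r IHr] b /=; first by rewrite cats0.
move=> /andP[xr ur] rb; have xb : x \in b by apply: rb; rewrite mem_head.
rewrite perm_sym; apply: perm_trans (perm_to_rem xb) _.
rewrite -[x :: r]cat1s perm_sym perm_catCA /= perm_cons; apply: IHr => // y yr.
have : y \in b by apply: rb; rewrite inE yr orbT.
by rewrite (perm_mem (perm_to_rem xb)) inE; case: eqP yr xr => // -> ->.
Qed.

Lemma perm_rest s b r : uniq r -> perm_eq (s ++ r) b -> perm_eq s (rest b r).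
Proof.
move=> ur srb; rewrite -(perm_cat2r r) (perm_trans srb) // perm_sym rest_perm //.
by move=> l lr; rewrite -(perm_mem srb) mem_cat lr orbT.
Qed.
Section Independence.
Variables (k : fieldType) (m i : nat) (b : seq nat).
Hypothesis two_neq0 : 2%:R != 0 :> k.
Hypothesis d_neq0 : (count_mem i b)%:R != 0 :> k.
Local Notation F := (freealg k).
Local Notation G := (grassmann k).
Local Notation X := (letter k).
Let sG := grassmann_super two_neq0.

(** The form of multidegree [b] with differential dt_I; the enumeration of [I] fixes the order of
    the commutators and [rest] that of the word. *)
Definition normal_word (I : {fset nat}) : F := word_lie X (rest b I) I.
Definition index_sets : {fset {fset nat}} := fpowerset [fset l in b | l != i]%fset.

Lemma index_setsP I : reflect ({subset I <= b} /\ i \notin I) (I \in index_sets).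
Proof.
rewrite /index_sets fpowersetE.
apply: (iffP idP) => [/fsubsetP Ib|[Ib iI]]; last apply/fsubsetP => l lI.
  split=> [l /Ib|]; first by rewrite !inE => /andP[].
  by apply/negP => /Ib; rewrite !inE eqxx andbF.
by rewrite !inE /= Ib //=; apply: contraNneq iI => <-.
Qed.

Lemma prod_gen_last_neq0 n : (n < m)%N ->
  \prod_(j <- iota 0 n ++ [:: m.-1]) gen k j != 0.
Proof.
move=> nm; rewrite prod_gen ?monalgU_eq0 ?oner_eq0 //.
apply: (@subseq_sorted _ ltn ltn_trans _ (iota 0 m)); last exact: iota_ltn_sorted.
rewrite -[m in X in subseq _ X](subnKC (ltnW nm)) iotaD add0n.
by rewrite cat_subseq // sub1seq mem_iota; lia.
Qed.

(* The word takes the value (1 + d e) E where e is the generator attached to x_i and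
   E is the product of those attached to r; the last generator e_(m-1), which is
   used by no letter, anticommutes with d e E. *)
Lemma central_coefficient (r : seq nat) c (phi : {lrmorphism F -> G}) :
    uniq r -> {subset r <= b} -> i \notin r -> ~~ odd (size r) ->
    ((size r).+1 < m)%N ->
    (forall l, phi (X l) =
       1 + (if l \in i :: r then gen k (index l (i :: r)) else 0)) ->
    c *: phi (word_lie X (rest b r) r) * gen k m.-1 =
      gen k m.-1 * (c *: phi (word_lie X (rest b r) r)) ->
  c = 0.
Proof.
move=> ur rb ir er rm phiE.
pose u l : G := if l \in i :: r then gen k (index l (i :: r)) else 0.
have uC x y : u x * u y = - (u y * u x).
  rewrite /u; case: ifP => _; case: ifP => _; rewrite ?mul0r ?mulr0 ?oppr0 //.
  exact: gen_anticomm.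
have u2 x : u x * u x = 0.
  by rewrite /u; case: ifP => _; rewrite ?mul0r //; exact: gen_sqr.
have -> : phi (word_lie X (rest b r) r) =
    (1 + u i *+ count_mem i b) * lie_prod u r.
  rewrite rmorph_word_lie.
  have -> : word_lie (phi \o X) (rest b r) r =
      word_lie (fun l => 1 + u l) (rest b r) r.
    rewrite /word_lie; congr (_ * _); first by apply: eq_bigr => l _; apply: phiE.
    by apply: eq_in_lie_prod => l _; apply: phiE.
  rewrite (anticommuting_word_lie uC u2 (i := i) er).
    rewrite -(permP (rest_perm ur rb)) count_cat.
    by rewrite [count_mem i r](count_memPn ir) addn0.
  by move=> l _; rewrite /u => /negbTE->.
have gL : gen k m.-1 * lie_prod u r = lie_prod u r * gen k m.-1.
  by rewrite (super_lie_prod_central sG).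
have uig : u i * gen k m.-1 = - (gen k m.-1 * u i).
  by rewrite /u mem_head; apply: gen_anticomm.
move=> /(central_anticommuting gL uig)/eqP.
rewrite (anticommuting_lie_prod (in2W uC) er) mulrnAr mulrnAl.
(* The generators attached to i and [r] are those numbered from 0 to [size r], all below m - 1. *)
have -> : u i * \prod_(l <- r) u l * gen k m.-1 =
    \prod_(j <- iota 0 (size r).+1 ++ [:: m.-1]) gen k j.
  rewrite big_cat big_seq1; congr (_ * _).
  have tE : iota 0 (size r).+1 = [seq index l (i :: r) | l <- i :: r].
    by rewrite map_index_uniq //= ir.
  rewrite prod_consE tE big_map.
  by apply: eq_big_seq => l; rewrite /u => ->.
rewrite -scalerMnr -mulrnA -scaler_nat scalerA scaler_eq0 => /orP[|/eqP E].
  have /negbTE N : (2 ^ (size r)./2 * (2 * count_mem i b))%:R != 0 :> k.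
    by rewrite !natrM natrX !mulf_neq0 ?expf_neq0.
  by rewrite mulf_eq0 N => /eqP.
by have := prod_gen_last_neq0 rm; rewrite E eqxx.
Qed.

(** Induction on the size of [I], evaluating at generators on i and [I] and at 1 elsewhere. Among
    the other sets J, the smaller ones have coefficient 0 by induction or odd size, and the rest are
    not contained in [I]. *)
Lemma coefficients_vanish (c : {fset nat} -> k) :
    central_valued m (\sum_(I <- index_sets) c I *: normal_word I) ->
  forall I, I \in index_sets -> ~~ odd #|` I| -> (#|` I|.+1 < m)%N -> c I = 0.
Proof.
move=> Hc I; have [n] := ubnP #|` I|; elim: n I => // n IHn I /ltnSE In IS eI Im.
have /index_setsP[Ib iI] := IS.
pose t : seq nat := i :: (I : seq nat).
pose v l : G := 1 + (if l \in t then gen k (index l t) else 0).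
have [|phi Hphi phiE] := @Gm_evaluation k m v.
  move=> l; rewrite /v; case: ifP => lI; last by rewrite addr0; apply: Gm1.
  rewrite -[1]scale1r; apply: GmZD; first exact: Gm1.
  apply: Gm_gen; apply: ltn_trans Im; move: lI; rewrite -index_mem.
  exact.
have [_ /(_ _ (Gm_gen _))] := Hc phi Hphi.
move=> /(_ m.-1); rewrite prednK ?leqnn; last by apply: leq_trans Im.
move=> /(_ isT); rewrite (linear_single (i := I)) ?fset_uniq //; last first.
  move=> J JS JI; rewrite rmorph_word_lie.
  have /index_setsP[Jb iJ] := JS.
  have [JltI|IleJ] := ltnP #|` J| #|` I|.
    have [oJ|eJ] := boolP (odd #|` J|).
      by right; rewrite /word_lie (super_lie_prodE sG) oJ mulr0.
    left; apply: IHn => //; first exact: leq_trans JltI In.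
    by apply: leq_trans Im; rewrite ltnS ltnW.
  (* A letter of J outside [I] takes the value 1, so its commutator vanishes. *)
  right; have /fsubsetPn[l lJ lI] : ~~ (J `<=` I)%fset.
    by apply: contraNN JI => sJI; rewrite eqEfcard sJI.
  apply: (word_lie_commuting0 _ lJ) => z.
  have li : l == i = false by apply: contraNF iJ => /eqP <-.
  by rewrite /= phiE /v inE li (negbTE lI) addr0 mul1r mulr1.
exact: (central_coefficient (fset_uniq I) Ib iI eI Im).
Qed.
End Independence.

(** * The main theorem *)

Section ModSpan.
Variables (k : fieldType) (L : lmodType k) (W : L -> Prop).
Variables (T : eqType) (S : seq T) (N : T -> L).
Hypothesis W0 : W 0.
Hypothesis WD : forall f g, W f -> W g -> W (f + g).
Hypothesis WZ : forall a f, W f -> W (a *: f).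

Definition mod_span (f : L) := exists c : T -> k, W (f - \sum_(i <- S) c i *: N i).

Lemma mod_span_sub f : W f -> mod_span f.
Proof.
by move=> Wf; exists (fun=> 0); rewrite big1 ?subr0 // => i _; rewrite scale0r.
Qed.

Lemma mod_spanD f g : mod_span f -> mod_span g -> mod_span (f + g).
Proof.
move=> [c Wc] [c' Wc']; exists (fun i => c i + c' i).
under eq_bigr do rewrite scalerDl.
by rewrite big_split opprD addrACA; apply: WD.
Qed.

Lemma mod_spanZ a f : mod_span f -> mod_span (a *: f).
Proof.
move=> [c Wc]; exists (fun i => a * c i).
under eq_bigr do rewrite -scalerA.
by rewrite -scaler_sumr -scalerBr; apply: WZ.
Qed.

Lemma mod_span_mem i : uniq S -> i \in S -> mod_span (N i).
Proof.
move=> uS iS; exists (fun j => (j == i)%:R).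
rewrite (bigD1_seq i) //= eqxx scale1r big1 ?addr0 ?subrr // => j /negbTE->.
by rewrite scale0r.
Qed.

(** The combination differs from f by an element of W, hence lies in V, and then its terms are
    forced into W. *)
Lemma mod_span_finish (V : L -> Prop) f :
    (forall g h, V g -> V h -> V (g - h)) -> (forall g, W g -> V g) ->
    (forall c : T -> k, V (\sum_(i <- S) c i *: N i) ->
       forall i, i \in S -> W (c i *: N i)) ->
  V f -> mod_span f -> W f.
Proof.
move=> VB WV H Vf [c Wc]; set g := \sum_(i <- S) c i *: N i in Wc.
have Vg : V g by rewrite -[g](subKr f); apply: VB => //; apply: WV.
rewrite -(subrK g f); apply: WD => //; rewrite /g big_seq.
by elim/big_ind: _ => // i; apply: H.
Qed.
End ModSpan.

Section MainTheorem.
Variables (k : fieldType) (p m : nat).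
Hypothesis two_neq0 : 2%:R != 0 :> k.
Hypothesis p_char :
  forall n, (n%:R == 0 :> k) = (if p == 0 then n == 0 else p %| n)%N.
Local Notation F := (freealg k).
Local Notation G := (grassmann k).
Local Notation X := (letter k).
Local Notation wl := (word_lie X).
Let sG := grassmann_super two_neq0.

Let p_eq0 : (0 < p)%N -> p%:R = 0 :> k.
Proof. by move=> p0; apply/eqP; rewrite p_char; case: eqP p0 => [->|]. Qed.

Definition S1m_TG : set F := sumset (S1m k p m) (TG k m).

Lemma S1m_TG_tspace : is_tspace S1m_TG.
Proof. by apply: sumset_tspace; [exact: S1m_tspace | exact: TG_tspace]. Qed.

Let W0 : S1m_TG 0. Proof. by have /is_tspaceP[] := S1m_TG_tspace. Qed.
Let WD f g : S1m_TG f -> S1m_TG g -> S1m_TG (f + g).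
Proof. by have /is_tspaceP[_ + _ _] := S1m_TG_tspace; apply. Qed.
Let WZ a f : S1m_TG f -> S1m_TG (a *: f).
Proof. by have /is_tspaceP[_ _ + _] := S1m_TG_tspace; apply. Qed.
Let Wphi (psi : {lrmorphism F -> F}) f : S1m_TG f -> S1m_TG (psi f).
Proof. by have /is_tspaceP[_ _ _] := S1m_TG_tspace; apply. Qed.

Lemma identity_in_S1m_TG f :
  (forall phi : {lrmorphism F -> G}, phi f = 0) -> S1m_TG f.
Proof.
by move=> Hf; apply: (sumset_subr (S1m_tspace k p m)); apply/TGP => phi _.
Qed.

Let Wmod f g : (forall phi : {lrmorphism F -> G}, phi f = phi g) ->
  S1m_TG f -> S1m_TG g.
Proof. exact: (mod_identities WD identity_in_S1m_TG). Qed.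

Lemma S1_in_S1m_TG f : S1 k p f -> S1m_TG f.
Proof. by move=> /(@S1_sub_S1m k p m); apply: (sumset_subl (TG_tspace k m)). Qed.

(** All generators of S_1(m) are nonunitary with central values. This serves both for
    [central_valued] and for [CP]. *)
Lemma S1m_TG_min (C : set F) : is_tspace C ->
  (forall g, central_or_identity m g -> C g) -> TG k m `<=` C -> S1m_TG `<=` C.
Proof.
move=> HC HgC TGC; apply: sumset_min => //; apply: sumset_min => //; last first.
  apply: tspace_gen_min => // _ ->; rewrite top_generatorE.
  exact/HgC/top_generator_central.
rewrite /S1; case: (posnP p) => [_|p0] /=.
  by apply: tspace_gen_min => // _ ->; apply/HgC/commutator_central.
apply: sumset_min => //; apply: tspace_gen_min => //.
  move=> _ [] ->; apply: HgC; first exact: commutator_central.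
  exact: (power_central m two_neq0 p_eq0).
move=> _ [n n0 <-].
have -> : var k (2 * n + 1) = letter k n.*2.
  by congr (letter k _); rewrite addn1 mul2n.
by apply/HgC/(wpoly_central m two_neq0 p_eq0).
Qed.

Lemma lie_in_S1m_TG f j : S1m_TG (lie f (X j)).
Proof.
have [psi psiE] := free_morphism (@free_scaleAr k)
  (fun l => if l == 0%N then f else X j).
have := Wphi psi (S1_in_S1m_TG (commutator_in_S1 k p)).
by rewrite rmorph_lie /= !psiE.
Qed.

(** A consequence of x h: the first m/2 commutators of [r] come from h, and x is replaced by the
    word times the remaining ones. *)
Lemma top_in_S1m_TG s r :
  ~~ odd (size r) -> (m < (size r).+2)%N -> S1m_TG (wl s r).
Proof.
move=> er mr; pose q := m./2.*2.
have qr : (q <= size r)%N.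
  rewrite /q -(even_halfK er) leq_double -ltnS -ltn_double doubleS (even_halfK er).
  by apply: leq_ltn_trans mr; case/andP: (half_bounds m).
have [psi psiE] := free_morphism (@free_scaleAr k)
  (fun l => if (l < q)%N then X (nth 0%N r l) else wl s (drop q r)).
have Wtop : S1m_TG (letter k q * lie_prod (letter k) (iota 0 q)).
  by apply: (sumset_subl (TG_tspace k m)); apply: top_in_S1m.
apply: Wmod (Wphi psi Wtop) => phi.
rewrite rmorphM rmorph_lie_prod /= psiE ltnn.
have -> : lie_prod (psi \o X) (iota 0 q) = lie_prod X (take q r).
  rewrite -(map_nth_iota0 0%N qr) lie_prod_map; apply: eq_in_lie_prod => l.
  by rewrite mem_iota add0n /= psiE => ->.
exact: (rmorph_word_lie_split phi _ _ sG qr).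
Qed.

Lemma pth_power_in_S1m_TG s r : (0 < p)%N -> uniq r -> ~~ odd (size r) ->
    (forall l, (p %| count_mem l (s ++ r))%N) ->
  exists s', perm_eq s s' /\ S1m_TG (wl s' r).
Proof.
move=> p0 ur er /(perm_pth_power p0 ur)[y sy]; exists (flatten (nseq p y) ++
  flatten [seq nseq p.-1 l | l <- r]); split=> //.
pose n := (size r)./2; have nr : n.*2 = size r by rewrite even_halfK.
have [psi psiE] := free_morphism (@free_scaleAr k)
  (fun l => if (l < n.*2)%N then X (nth 0%N r l) else \prod_(x <- y) X x).
(* Without commutators the generator x^p is used, since w_n starts at n = 1. *)
have [r0|r0] := posnP (size r).
  have := Wphi psi (S1_in_S1m_TG (power_in_S1 k p0)).
  rewrite rmorphXn /= psiE nr r0 /= (size0nil r0) /= cats0 /word_lie mulr1.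
  congr S1m_TG; elim: (p) => [|i IHi]; first by rewrite big_nil.
  by rewrite exprS IHi big_cat.
have n0 : (0 < n)%N by rewrite -double_gt0 nr.
apply: Wmod (Wphi psi (S1_in_S1m_TG (wpoly_in_S1 k p0 n0))) => phi.
rewrite rmorph2_exprM /= psiE ltnn rmorph_prod.
have /= -> := rmorph_wpoly p two_neq0 (phi \o psi : {lrmorphism F -> G}) n.
rewrite nr rmorph_word_lie; apply: word_lie_pth_power => l lr.
by rewrite /= psiE nr lr.
Qed.

Lemma pth_power_words b : (0 < p)%N -> (forall l, (p %| count_mem l b)%N) ->
  forall s r, perm_eq (s ++ r) b -> S1m_TG (word_lie X s r).
Proof.
move=> p0 pb; apply: (spanning_of_representatives sG W0 WD WZ
  identity_in_S1m_TG) => s r srb ur er.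
have [|s' [ss' Ws']] := @pth_power_in_S1m_TG s r p0 ur er.
  by move=> l; rewrite (permP srb).
by exists s', r.
Qed.

(** Here [spanning_off_letter] is applied to the subspace [mod_span], with the normal words as
    representatives. *)
Lemma words_mod_span b i : (count_mem i b)%:R != 0 :> k ->
  forall s r, perm_eq (s ++ r) b ->
  mod_span S1m_TG (index_sets i b) (normal_word k b) (word_lie X s r).
Proof.
move=> ib; apply: (spanning_off_letter sG _ _ _ _ ib).
- exact: mod_span_sub.
- exact: mod_spanD.
- exact: mod_spanZ.
- by move=> f Hf; apply: mod_span_sub => //; apply: identity_in_S1m_TG.
- by move=> f j; apply: mod_span_sub => //; apply: lie_in_S1m_TG.
move=> s r srb ur er ir; pose I := [fset l in r]%fset.
have rI : perm_eq r I by apply: uniq_perm => // [|l]; rewrite ?fset_uniq ?inE.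
exists (rest b I), I; split=> //.
  apply: perm_rest; rewrite ?fset_uniq // (perm_trans _ srb) //.
  by rewrite perm_cat2l perm_sym.
apply: (mod_span_mem (normal_word k b) W0 (fset_uniq _)).
apply/index_setsP; split=> [l|]; last by rewrite !inE.
by rewrite !inE -(perm_mem srb) mem_cat => ->; rewrite orbT.
Qed.

Lemma central_valuedB (f g : F) : central_valued m f -> central_valued m g ->
  central_valued m (f - g).
Proof.
have /is_tspaceP[_ VD VZ _] := central_valued_tspace k m.
by move=> Vf /(VZ (-1)); rewrite scaleN1r; apply: VD.
Qed.

Lemma S1m_TG_central_valued : S1m_TG `<=` central_valued m.
Proof.
apply: S1m_TG_min; first exact: central_valued_tspace.
  by move=> g [].
exact: TG_central_valued.
Qed.

(** Odd sets give identities, small even sets have coefficient 0, and large even sets carry enough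
    commutators for [top_in_S1m_TG]. *)
Lemma normal_words_in_S1m_TG b i c : (count_mem i b)%:R != 0 :> k ->
    central_valued m (\sum_(I <- index_sets i b) c I *: normal_word k b I) ->
  forall I, I \in index_sets i b -> S1m_TG (c I *: normal_word k b I).
Proof.
move=> ib Vc I IS.
have [oI|eI] := boolP (odd #|` I|).
  apply/WZ/identity_in_S1m_TG => phi.
  by rewrite rmorph_word_lie /word_lie (super_lie_prodE sG) oI mulr0.
have [Im|mI] := ltnP #|` I|.+1 m; last exact/WZ/top_in_S1m_TG.
by rewrite (coefficients_vanish two_neq0 ib Vc IS eI Im) scale0r.
Qed.

Lemma homogeneous_in_S1m_TG f : central_or_identity m f ->
    (forall w w', w \in msupp f -> w' \in msupp f -> perm_eq (w : seq nat) w') ->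
  S1m_TG f.
Proof.
move=> [Vf nf] fw; have [f0|[b bf]] := fset_0Vmem (msupp f).
  by have /eqP -> : f == 0 by rewrite -msupp_eq0 f0.
have word_lie0 s : word k s = word_lie X s [::] by rewrite /word_lie mulr1.
have fwb (w : {fmonom nat}) : w \in msupp f -> perm_eq ((w : seq nat) ++ [::]) b.
  by rewrite cats0 => /fw; apply.
(* The Cartier case: all partial degrees vanish in k. *)
have [bp|] := boolP (all (fun i => (count_mem i b)%:R == 0 :> k) b).
  have cb l : (count_mem l b)%:R == 0 :> k.
    have [/(allP bp)//|/count_memPn->] := boolP (l \in (b : seq nat)).
    by rewrite eqxx.
  (* In characteristic 0 the degrees themselves vanish, and f would have a constant term. *)
  have [pz|p0] := posnP p.
    suff b1 : b = mone by move: bf; rewrite b1 -mcoeff_neq0 nf eqxx.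
    apply/eqP; rewrite fmP fm1 -size_eq0 -all_pred0; apply/allP => l lb.
    by move: (cb l); rewrite p_char pz eqxx => /eqP/count_memPn; rewrite lb.
  rewrite (free_expand f) big_seq; elim/big_ind: _ => // w /fwb wb.
  rewrite word_lie0; apply/WZ/(pth_power_words p0 _ wb) => l.
  by move: (cb l); rewrite p_char gtn_eqF.
(* The Poincare case: integrate with respect to x_i. *)
case/allPn => i _ ib.
apply: (mod_span_finish W0 WD central_valuedB S1m_TG_central_valued
  (fun c => @normal_words_in_S1m_TG b i c ib) Vf).
rewrite (free_expand f) big_seq; elim/big_ind: _ => [||w /fwb wb].
- exact: mod_span_sub.
- exact: mod_spanD.
- by rewrite word_lie0; apply: mod_spanZ => //; apply: words_mod_span wb.
Qed.

Hypothesis k_infinite : infinite_set [set: k].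

Lemma central_or_identity_in_S1m_TG f : central_or_identity m f -> S1m_TG f.
Proof.
have /is_tspaceP[V0 VD VZ Vphi] := central_valued_tspace k m.
move: f; apply: (@multihomogeneous_reduction k k_infinite (central_or_identity m)).
- by split; [exact: V0 | rewrite /nonunitary /= mcoeff0].
- move=> f g [Vf nf] [Vg ng]; split; first exact: VD.
  by rewrite /nonunitary /= mcoeffD nf ng addr0.
- move=> a f [Vf nf]; split; first exact: VZ.
  by rewrite /nonunitary /= mcoeffZ nf mulr0.
- move=> psi psiE f [Vf nf]; split; first exact: Vphi.
  (* A dilation followed by evaluation at zero still sends every letter to 0, so the constant term
     stays 0. *)
  apply: nonunitaryP => phi phi0.
  rewrite -[LHS]/((phi \o psi : {lrmorphism F -> G}) f) free_morphism_eq0.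
    by rewrite nf scale0r.
  by move=> l; have [t tE] := psiE l; rewrite /= tE linearZ /= phi0 scaler0.
- exact: W0.
- exact: WD.
- exact: homogeneous_in_S1m_TG.
Qed.

Hypothesis m_gt0 : (0 < m)%N.

(* An identity f is the difference of the central polynomials f + h and h. *)
Lemma TG_in_CP : TG k m `<=` CP k m.
Proof.
have /is_tspaceP[_ CD CZ _] := tspace_gen_tspace (central_polynomial k m).
have /is_tspaceP[_ TD TZ _] := TG_tspace k m.
set h := letter k m./2.*2 * lie_prod (letter k) (iota 0 m./2.*2).
have [Vh nh] : central_or_identity m h := top_generator_central m two_neq0.
have Th : ~ TG k m h := top_not_identity two_neq0 m_gt0.
move=> f Tf; have -> : f = (f + h) + (-1) *: h by rewrite scaleN1r addrK.
apply: CD; last first.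
  by apply: CZ; apply: sub_tspace_gen; split.
apply: sub_tspace_gen; split.
- by rewrite /nonunitary /= mcoeffD nh addr0; case: Tf.
- move=> Tfh; apply: Th; have -> : h = (f + h) + (-1) *: f.
    by rewrite scaleN1r addrAC subrr add0r.
  by apply: TD => //; apply: TZ.
- have /is_tspaceP[_ VD _ _] := central_valued_tspace k m.
  exact: (VD _ _ (TG_central_valued Tf) Vh).
Qed.

Lemma CP_eq : CP k m = S1m_TG.
Proof.
rewrite eqEsubset; split.
  apply: tspace_gen_min; first exact: S1m_TG_tspace.
  by move=> f [nf _ Vf]; apply: central_or_identity_in_S1m_TG; split.
apply: S1m_TG_min.
- exact: tspace_gen_tspace.
- move=> g [Vg ng]; have [Tg|Tg] := pselect (TG k m g); first exact: TG_in_CP.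
  by apply: sub_tspace_gen; split.
- exact: TG_in_CP.
Qed.
End MainTheorem.

Unset Implicit Arguments.

Theorem theorem2p1 (k : fieldType) (p m : nat)
  (k_infinite : infinite_set [set: k])
  (k_char : has_characteristic k p) (p_neq2 : p <> 2%N) (m_gt0 : (0 < m)%N) :
  CP k m = sumset (S1m k p m) (TG k m).
Proof.
have p_char n : (n%:R == 0 :> k) = (if p == 0 then n == 0 else p %| n)%N.
  move: k_char; rewrite /has_characteristic.
  by case: eqP => [_ /pcharf0P|_ /dvdn_pcharf] ->.
apply: CP_eq => //; rewrite p_char; case: eqP => // p0.
move: k_char; rewrite /has_characteristic; case: eqP => // _ /pcharf_prime pp.
by rewrite dvdn_prime2 //; apply/eqP.
Qed.
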